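(* Suppose that every von Neumann algebra acting on a separable Hilbert space is singly generated (i.e. generated as a von Neumann algebra by a single element). Then the following two statements are equivalent. (i) For every Hilbert space $H$, every hyperreflexive von Neumann algebra $\mathcal{A}\subseteq B(H)$ and every projection $Q\in B(H)$, the von Neumann algebra $\mathcal{A}\vee\{Q\}''$ is hyperreflexive. (ii) For every Hilbert space $H$, every $n\in\mathbb{N}$ and all projections $Q_1,\dots,Q_n\in B(H)$, the von Neumann algebra $\{Q_1\}'\cap\dots\cap\{Q_n\}'$ is hyperreflexive.
   Context: $B(H)$ is the space of bounded linear operators on a Hilbert space $H$, and $'$ denotes the commutant in $B(H)$. For an operator space $\mathcal{X}\subseteq B(H)$ and $T\in B(H)$, put $r_{\mathcal{X}}(T)=\sup\{|\langle T\xi,\eta\rangle| : \|\xi\|=\|\eta\|=1,\ \langle X\xi,\eta\rangle=0\ \forall X\in\mathcal{X}\}$ and $d(T,\mathcal{X})=\inf_{X\in\mathcal{X}}\|T-X\|$. A reflexive space $\mathcal{X}\subseteq B(H)$ (i.e. one for which $T\in\mathcal{X}$ whenever $T\xi\in\overline{\mathcal{X}\xi}$ for all $\xi\in H$; von Neumann algebras are reflexive) is hyperreflexive if there is $k>0$ with $d(T,\mathcal{X})\le k\,r_{\mathcal{X}}(T)$ for all $T\in B(H)$. $\mathcal{A}\vee\{Q\}''$ denotes the von Neumann algebra generated by $\mathcal{A}$ and $\{Q\}''$. *)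

(* Defs.v *)
From mathcomp Require Import all_boot all_order all_algebra.
From mathcomp Require Export complex.
From mathcomp Require Import all_classical all_reals all_analysis.

Set Implicit Arguments.
Unset Strict Implicit.
Unset Printing Implicit Defensive.

Import Order.TTheory GRing.Theory Num.Theory.
Import numFieldNormedType.Exports.

Local Open Scope classical_set_scope.
Local Open Scope ring_scope.
Local Open Scope complex_scope.

(* [hdot] is linear in its first argument, conjugate-linear in the second. *)
Record hilbertSpace (R : realType) := HilbertSpace {
  hcarrier :> completeNormedModType R[i];
  hdot : {dot hcarrier for Num.conj};
  hdot_norm : forall x : hcarrier, `|x| ^+ 2 = hdot x x
}.

Arguments hdot {R h}.

Section HilbertSpaceOperators.
Context {R : realType} {H : hilbertSpace R}.
Implicit Types (T S Q : H -> H) (A B X : set (H -> H)) (x y : H).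

(* The norm of a normed module over R[i] takes its values in R[i]. *)
Definition hnorm x : R := complex.Re `|x|.

Definition separable_space : Prop :=
  exists2 D : set H, countable D & dense D.

Definition bounded_op : set (H -> H) :=
  [set T | linear T /\ exists M : R, forall x, hnorm (T x) <= M * hnorm x].

Definition opnorm T : R := sup [set hnorm (T x) | x in [set x | hnorm x <= 1]].

Definition adjoint T S : Prop := forall x y, hdot (T x) y = hdot x (S y).

Definition projection Q : Prop :=
  [/\ bounded_op Q, Q \o Q = Q & adjoint Q Q].

Definition commutant A : set (H -> H) :=
  [set T | bounded_op T /\ forall S, A S -> T \o S = S \o T].

Definition op_subspace X : Prop :=
  [/\ X `<=` bounded_op, X (fun=> 0),
      forall T S, X T -> X S -> X (fun x => T x + S x)
    & forall (c : R[i]) T, X T -> X (fun x => c *: T x)].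

Definition star_algebra A : Prop :=
  [/\ op_subspace A,
      A id,
      forall T S, A T -> A S -> A (T \o S)
    & forall T S, A T -> bounded_op S -> adjoint T S -> A S].

Definition von_neumann_algebra A : Prop :=
  star_algebra A /\ commutant (commutant A) = A.

Definition vN_generated A : set (H -> H) :=
  [set T | forall B, von_neumann_algebra B -> A `<=` B -> B T].

Definition vN_join A B : set (H -> H) := vN_generated (A `|` B).

Definition singly_generated A : Prop :=
  exists2 T, bounded_op T & A = vN_generated [set T].

Definition reflexive_space X : Prop :=
  op_subspace X /\
  forall T, bounded_op T ->
    (forall x, closure [set S x | S in X] (T x)) -> X T.

(* When no pair (x, y) is admissible, e.g. for X = B(H), the supremum is over
   the empty set and is 0, as [sup set0 = 0]. *)
Definition seminorm_r X T : R :=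
  sup [set c | exists x y, [/\ hnorm x = 1, hnorm y = 1,
                 forall S, X S -> hdot (S x) y = 0
               & c = complex.Re `|hdot (T x) y|]].

Definition op_dist T X : R :=
  inf [set opnorm (fun x => T x - S x) | S in X].

Definition hyperreflexive X : Prop :=
  reflexive_space X /\
  exists2 k : R, 0 < k &
    forall T, bounded_op T -> op_dist T X <= k * seminorm_r X T.

End HilbertSpaceOperators.

Arguments separable_space {R} H.

(* Main.v *)
Require Import Defs.
From HB Require Import structures.
From mathcomp Require Import all_boot all_order all_algebra.
From mathcomp Require Import all_classical all_reals all_analysis.
From mathcomp Require Import ring lra.

(** Both conditions are equivalent to the hyperreflexivity of every von Neumann algebra.
    This condition implies each of them, because joins of von Neumann algebras and
    commutants of projections are von Neumann algebras.

    For the converse, consider first a separable [H], on which every von Neumann algebra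
    is generated by some operator [T]. The projections of [H (+) H] onto the first axis,
    the diagonal and the graph of [T] have as common commutant the operators [S (+) S]
    with [S] commuting with [T] and its adjoint ([commutant_graph_proj]).

    - If joins with projections preserve hyperreflexivity, take [T] generating [A].
      The scalars are hyperreflexive, and adjoining the three projections yields the 2
      by 2 matrices over [A]. Passing to a corner, [A] is hyperreflexive
      ([hyperreflexive_of_joins]).

    - If commutants of finitely many projections are hyperreflexive, take [T]
      generating the commutant [A']. Then the operators [S (+) S] with [S] in [A] form
      a hyperreflexive algebra on [H (+) H] ([hyperreflexive_of_projection_commutants]).
      Its rank-one annihilators are functionals of rank two on [A], which have to be
      bounded by those of rank one ([rank_two_bound]). This reduces to bounding the
      commutators of an operator with contractions in [A'] by its commutators with
      projections in [A'], that is, to spectral theory: a self-adjoint contraction [b]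
      is [P - 1/2 + b'/2] with [P] a spectral projection and [b'] another
      self-adjoint contraction ([halve_selfadjoint]), and iterating this yields the
      bound.

    Arbitrary spaces reduce to separable ones ([hyperreflexive_of_separable]): by weak
    compactness of balls of operators ([weak_compactness]), a lower bound for the
    distance of an operator to [A] is already visible on countably many vectors and
    countably many elements of [A'], all of which live on a separable reducing subspace.

    Hyperreflexivity is used throughout in the form of [distance_estimate], phrased with
    the real part [rdot] of the inner product. *)

Set Implicit Arguments.
Unset Strict Implicit.
Unset Printing Implicit Defensive.

Import Order.TTheory GRing.Theory Num.Theory.
Import numFieldNormedType.Exports.

Local Open Scope classical_set_scope.
Local Open Scope ring_scope.
Local Open Scope complex_scope.

(** * Hilbert spaces built from inner products *)

Section InnerProduct.
Context {R : realType} {V : lmodType R[i]}.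

Definition inner_product (ip : V -> V -> R[i]) : Prop :=
  [/\ forall c x y z, ip (c *: x + y) z = c * ip x z + ip y z,
      forall x y, ip y x = Num.conj (ip x y)
    & forall x, x != 0 -> 0 < ip x x].

Variable ip : V -> V -> R[i].
Hypothesis ipP : inner_product ip.

Definition re_ip x y : R := complex.Re (ip x y).

Definition ip_norm x : R := Num.sqrt (re_ip x x).

Let ipl : forall c x y z, ip (c *: x + y) z = c * ip x z + ip y z.
Proof. by case: ipP. Qed.

Let ipC : forall x y, ip y x = Num.conj (ip x y).
Proof. by case: ipP. Qed.

Lemma ipDl x y z : ip (x + y) z = ip x z + ip y z.
Proof. by rewrite -{1}[x]scale1r ipl mul1r. Qed.

Lemma ip0l z : ip 0 z = 0.
Proof. by apply: (addrI (ip 0 z)); rewrite -ipDl !addr0. Qed.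

Lemma ipZl c x z : ip (c *: x) z = c * ip x z.
Proof. by rewrite -[c *: x]addr0 ipl ip0l addr0. Qed.

Lemma re_ipDl x y z : re_ip (x + y) z = re_ip x z + re_ip y z.
Proof. by rewrite /re_ip ipDl; case: (ip x z) (ip y z) => a b []. Qed.

Lemma re_ipC x y : re_ip x y = re_ip y x.
Proof. by rewrite /re_ip [ip y x]ipC; case: (ip x y). Qed.

Lemma re_ipDr x y z : re_ip x (y + z) = re_ip x y + re_ip x z.
Proof. by rewrite re_ipC re_ipDl !(re_ipC x). Qed.

Lemma re_ipZl (a : R) x y : re_ip (a%:C *: x) y = a * re_ip x y.
Proof. by rewrite /re_ip ipZl; case: (ip x y) => u v /=; rewrite mul0r subr0. Qed.

Lemma re_ipZr (a : R) x y : re_ip x (a%:C *: y) = a * re_ip x y.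
Proof. by rewrite re_ipC re_ipZl re_ipC. Qed.

Lemma re_ip_gt0 x : x != 0 -> 0 < re_ip x x.
Proof. by case: ipP => _ _ /(_ x) h /h; rewrite ltcE => /andP[]. Qed.

Lemma re_ip_ge0 x : 0 <= re_ip x x.
Proof.
have [->|/re_ip_gt0/ltW //] := eqVneq x 0.
by rewrite /re_ip ip0l.
Qed.

Lemma ip_real x : ip x x = (re_ip x x)%:C.
Proof.
have [->|x0] := eqVneq x 0; first by rewrite /re_ip ip0l.
case: ipP => _ _ /(_ x x0); rewrite ltcE /re_ip.
by case: (ip x x) => a b /= /andP[/eqP -> _].
Qed.

Lemma ip_norm_sqr x : ip_norm x ^+ 2 = re_ip x x.
Proof. by rewrite sqr_sqrtr ?re_ip_ge0. Qed.

Lemma ip_norm_ge0 x : 0 <= ip_norm x.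
Proof. exact: sqrtr_ge0. Qed.

Lemma ip_norm0_eq0 x : ip_norm x = 0 -> x = 0.
Proof.
move=> h; apply/eqP; case: (eqVneq x 0) => // /re_ip_gt0.
by rewrite -ip_norm_sqr h expr0n /= ltxx.
Qed.

Lemma re_ip_CS x y : re_ip x y <= ip_norm x * ip_norm y.
Proof.
have [->|y0] := eqVneq y 0.
  by rewrite re_ipC /re_ip ip0l mulr_ge0 ?ip_norm_ge0.
have Y0 := re_ip_gt0 y0.
have X0 := re_ip_ge0 x.
have := re_ip_ge0 (x + (- (re_ip x y / re_ip y y))%:C *: y).
rewrite re_ipDl !re_ipDr !re_ipZl !re_ipZr (re_ipC y x).
set B := re_ip x y; set Y := re_ip y y in Y0 *; set X := re_ip x x in X0 *.
have -> : X + - (B / Y) * B + (- (B / Y) * B + - (B / Y) * (- (B / Y) * Y))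
   = X - B ^+ 2 / Y.
  by field; rewrite gt_eqF.
rewrite subr_ge0 ler_pdivrMr // => h.
rewrite /ip_norm -sqrtrM // -/X -/Y.
apply: (le_trans (ler_norm B)); rewrite -sqrtr_sqr.
by rewrite ler_sqrt // mulr_ge0 // ltW.
Qed.

Lemma ip_normD x y : ip_norm (x + y) <= ip_norm x + ip_norm y.
Proof.
rewrite -(@ler_pXn2r _ 2) ?nnegrE ?addr_ge0 ?ip_norm_ge0 //.
rewrite ip_norm_sqr re_ipDl !re_ipDr (re_ipC y x) -!ip_norm_sqr.
have := re_ip_CS x y; nra.
Qed.

Lemma ip_normZ c x : (ip_norm (c *: x))%:C = `|c| * (ip_norm x)%:C.
Proof.
rewrite normc_def -rmorphM -sqrtrM ?addr_ge0 ?sqr_ge0 //.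
congr (Num.sqrt _)%:C; rewrite [LHS]/re_ip ipZl ipC ipZl ip_real.
by case: c => a b /=; rewrite /re_ip /=; ring.
Qed.

End InnerProduct.

(** Completeness is stated for Cauchy filters, the form in which it passes to direct
    squares (coordinatewise) and to closed subspaces. *)
Definition ip_complete (R : realType) (V : lmodType R[i])
    (ip : V -> V -> R[i]) : Prop :=
  forall F : set_system V, ProperFilter F ->
  (forall e : R, 0 < e -> exists x, F [set y | ip_norm ip (x - y) < e]) ->
  exists l, forall e : R, 0 < e -> F [set y | ip_norm ip (l - y) < e].

(** A copy of [V], on which the norm of the inner product can be declared without
    interfering with a norm that [V] may already carry. *)
Definition ip_space (R : realType) (V : lmodType R[i]) (ip : V -> V -> R[i])
  (ipP : inner_product ip) (ip_cpl : ip_complete ip) : Type := V.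

Section IpSpace.
Variables (R : realType) (V : lmodType R[i]) (ip : V -> V -> R[i]).
Variables (ipP : inner_product ip) (ip_cpl : ip_complete ip).

Local Notation W := (ip_space ipP ip_cpl).

HB.instance Definition _ := GRing.Lmodule.on W.

Definition ip_space_norm (x : W) : R[i] := (ip_norm ip x)%:C.

Lemma ip_space_normD (x y : W) :
  ip_space_norm (x + y) <= ip_space_norm x + ip_space_norm y.
Proof. by rewrite /ip_space_norm -rmorphD lecR; exact: ip_normD. Qed.

Lemma ip_space_normZ (c : R[i]) (x : W) :
  ip_space_norm (c *: x) = `|c| * ip_space_norm x.
Proof. exact: ip_normZ. Qed.

Lemma ip_space_norm_eq0 (x : W) : ip_space_norm x = 0 -> x = 0.
Proof. by case=> /(ip_norm0_eq0 ipP). Qed.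

HB.instance Definition _ := Lmodule_isNormed.Build R[i] W
  ip_space_normD ip_space_normZ ip_space_norm_eq0.

Definition ip_space_dot (x y : W) : R[i] := ip x y.

Lemma ip_space_dot_linearl (y : W) :
  GRing.linear_for ( *%R ) (ip_space_dot ^~ y).
Proof. by move=> c u v; case: ipP => + _ _; exact. Qed.

Lemma ip_space_dot_linearr (x : W) :
  GRing.linear_for (Num.conj \; *%R ) (ip_space_dot x).
Proof.
move=> c u v; rewrite /ip_space_dot; case: ipP => l C _.
by rewrite /= (C (c *: u + v) x) l rmorphD rmorphM (C u x) (C v x).
Qed.

HB.instance Definition _ := isBilinear.Build R[i] W W R[i] _ _ ip_space_dot
  (fun u' => zmod_morphism_linear (ip_space_dot_linearl u'))
  (fun u => zmod_morphism_linear (ip_space_dot_linearr u))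
  (fun u' => scalable_linear (ip_space_dot_linearl u'))
  (fun u => scalable_linear (ip_space_dot_linearr u)).

Lemma ip_space_dotC (x y : W) :
  ip_space_dot x y = (-1) ^+ false * Num.conj (ip_space_dot y x).
Proof. by rewrite expr0 mul1r; case: ipP => _ + _; exact. Qed.

HB.instance Definition _ := isHermitianSesquilinear.Build R[i] W false Num.conj
  ip_space_dot ip_space_dotC.

Lemma ip_space_dot_gt0 (x : W) : x != 0 -> 0 < ip_space_dot x x.
Proof. by case: ipP => _ _; exact. Qed.

HB.instance Definition _ := isDotProduct.Build R[i] W
  ip_space_dot ip_space_dot_gt0.

Lemma ip_space_norm_dot (x : W) : `|x| ^+ 2 = ip_space_dot x x.
Proof.
by rewrite /ip_space_dot (ip_real ipP) -(ip_norm_sqr ipP) rmorphXn.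
Qed.

Lemma ip_space_complete (F : set_system W) :
  ProperFilter F -> cauchy F -> cvg F.
Proof.
move=> FF /cauchyP Fc.
have [|l Fl] := ip_cpl FF.
  move=> e e0; have [|x Fx] := Fc e%:C; first by rewrite ltcR.
  exists x; apply: filterS Fx => y; rewrite -ball_normE /=.
  by rewrite /Num.norm /= /ip_space_norm ltcR.
apply: (@cvgP _ _ (l : W)); apply/fcvg_ballP => e e0.
have e0' : 0 < complex.Re e by move: e0; rewrite ltcE => /andP[].
apply: filterS (Fl _ e0') => y yl; rewrite -ball_normE /=.
rewrite ltcE /= yl andbT; move: e0; rewrite ltcE => /andP[/eqP -> _].
by [].
Qed.

HB.instance Definition _ := Uniform_isComplete.Build W ip_space_complete.

Definition hilbert_of_ip : hilbertSpace R :=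
  @HilbertSpace R W ip_space_dot ip_space_norm_dot.

End IpSpace.

(** * The real inner product and the metric *)

Section RealInnerProduct.
Context {R : realType} {H : hilbertSpace R}.
Implicit Types (x y z : H) (a : R) (c : R[i]).

Definition rdot x y : R := complex.Re (hdot x y).

Lemma hdot_inner_product : inner_product (@hdot R H).
Proof.
split=> [c x y z|x y|x x0]; first by rewrite linearPl.
- by rewrite hermC expr0 mul1r.
- exact: neq0_dnorm_gt0.
Qed.
Let ipH := hdot_inner_product.

Lemma rdotDl x y z : rdot (x + y) z = rdot x z + rdot y z.
Proof. exact: (re_ipDl ipH). Qed.

Lemma rdotC x y : rdot x y = rdot y x.
Proof. exact: (re_ipC ipH). Qed.

Lemma rdotDr x y z : rdot x (y + z) = rdot x y + rdot x z.
Proof. exact: (re_ipDr ipH). Qed.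

Lemma rdotZl a x y : rdot (a%:C *: x) y = a * rdot x y.
Proof. exact: (re_ipZl ipH). Qed.

Lemma rdotZr a x y : rdot x (a%:C *: y) = a * rdot x y.
Proof. exact: (re_ipZr ipH). Qed.

Lemma rdot0l y : rdot 0 y = 0.
Proof. by rewrite /rdot linear0l. Qed.

Lemma rdot0r y : rdot y 0 = 0.
Proof. by rewrite rdotC rdot0l. Qed.

Lemma rdotNl x y : rdot (- x) y = - rdot x y.
Proof. by apply: (addrI (rdot x y)); rewrite -rdotDl !subrr rdot0l. Qed.

Lemma rdotNr x y : rdot x (- y) = - rdot x y.
Proof. by rewrite rdotC rdotNl rdotC. Qed.

Lemma rdotBl x y z : rdot (x - y) z = rdot x z - rdot y z.
Proof. by rewrite rdotDl rdotNl. Qed.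

Lemma rdotBr x y z : rdot x (y - z) = rdot x y - rdot x z.
Proof. by rewrite rdotDr rdotNr. Qed.

Definition rdotE := (rdotDl, rdotDr, rdotNl, rdotNr, rdotZl, rdotZr).

Lemma hnorm_ip x : hnorm x = ip_norm hdot x.
Proof.
have h : 0 <= hnorm x by have := normr_ge0 x; rewrite lecE => /andP[].
have e : (hnorm x)%:C = `|x| by rewrite /hnorm RRe_real // ger0_real.
apply/eqP; rewrite -(@eqrXn2 _ 2) ?ip_norm_ge0 // (ip_norm_sqr ipH).
by apply/eqP/complexI; rewrite -(ip_real ipH) -hdot_norm rmorphXn /= e.
Qed.

Lemma hnorm_ge0 x : 0 <= hnorm x.
Proof. by rewrite hnorm_ip ip_norm_ge0. Qed.

Lemma normr_hnorm x : `|x| = (hnorm x)%:C.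
Proof. by rewrite /hnorm RRe_real // ger0_real. Qed.

Lemma hnorm_sqr x : hnorm x ^+ 2 = rdot x x.
Proof. by rewrite hnorm_ip (ip_norm_sqr ipH). Qed.

Lemma hnorm_eq0 x : hnorm x = 0 -> x = 0.
Proof. by rewrite hnorm_ip => /(ip_norm0_eq0 ipH). Qed.

Lemma hnorm0 : hnorm (0 : H) = 0.
Proof. by rewrite /hnorm normr0. Qed.

Lemma hnorm_gt0 x : x != 0 -> 0 < hnorm x.
Proof.
move=> x0; rewrite lt_neqAle hnorm_ge0 andbT eq_sym.
by apply: contra x0 => /eqP h; apply/eqP/hnorm_eq0.
Qed.

Lemma hnorm_leD x y : hnorm (x + y) <= hnorm x + hnorm y.
Proof. by rewrite !hnorm_ip (ip_normD ipH). Qed.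

Lemma hnorm_opp x : hnorm (- x) = hnorm x.
Proof. by rewrite /hnorm normrN. Qed.

Lemma hnorm_leB x y : hnorm (x - y) <= hnorm x + hnorm y.
Proof. by rewrite -(hnorm_opp y) hnorm_leD. Qed.

Lemma hdistC x y : hnorm (x - y) = hnorm (y - x).
Proof. by rewrite -hnorm_opp opprB. Qed.

Lemma hnormZ c x : hnorm (c *: x) = complex.Re `|c| * hnorm x.
Proof.
by rewrite {1}/hnorm normrZ normr_hnorm normc_def /= mulr0 subr0.
Qed.

Lemma hnormZr a x : hnorm (a%:C *: x) = `|a| * hnorm x.
Proof. by rewrite hnormZ normc_def /= expr0n /= addr0 sqrtr_sqr. Qed.

Lemma rdot_CS x y : rdot x y <= hnorm x * hnorm y.
Proof. by rewrite !hnorm_ip (re_ip_CS ipH). Qed.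

Lemma norm_rdot_CS x y : `|rdot x y| <= hnorm x * hnorm y.
Proof. by rewrite ler_norml rdot_CS andbT lerNl -rdotNl -(hnorm_opp x) rdot_CS. Qed.

Lemma hdotC x y : hdot y x = (hdot x y)^*.
Proof. by rewrite hermC expr0 mul1r. Qed.

Lemma hdotZl c x y : hdot (c *: x) y = c * hdot x y.
Proof. exact: (ipZl ipH). Qed.

Lemma hdotZr c x y : hdot x (c *: y) = c^* * hdot x y.
Proof. by rewrite hdotC hdotZl rmorphM /= -hdotC. Qed.

Lemma hdotZr_real a x y : hdot x (a%:C *: y) = a%:C * hdot x y.
Proof.
by rewrite hdotZr; congr (_ * _); apply/eqP; rewrite eq_complex /= oppr0 !eqxx.
Qed.

Lemma hdotZr_i x y : hdot x ('i *: y) = - 'i * hdot x y.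
Proof.
by rewrite hdotZr; congr (_ * _); apply/eqP; rewrite eq_complex /= oppr0 !eqxx.
Qed.

Lemma hdotDl x y z : hdot (x + y) z = hdot x z + hdot y z.
Proof. by rewrite linearDl. Qed.

Lemma hdotDr x y z : hdot x (y + z) = hdot x y + hdot x z.
Proof. by rewrite linearDr. Qed.

Lemma hdotBl x y z : hdot (x - y) z = hdot x z - hdot y z.
Proof. by rewrite linearBl. Qed.

Lemma hdotBr x y z : hdot x (y - z) = hdot x y - hdot x z.
Proof. by rewrite linearBr. Qed.

Lemma hdot0l y : hdot 0 y = 0.
Proof. by rewrite linear0l. Qed.

Lemma hdot0r y : hdot y 0 = 0.
Proof. by rewrite linear0r. Qed.

Lemma hdotE x y : hdot x y = rdot x y +i* rdot x ('i *: y).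
Proof.
rewrite /rdot hdotZr; case: (hdot x y) => a b /=.
by congr (_ +i* _); ring.
Qed.

Lemma rdot_i x y : rdot ('i *: x) y = - rdot x ('i *: y).
Proof.
rewrite /rdot hdotZr hdotZl; case: (hdot x y) => a b /=; ring.
Qed.

Lemma hdot_eq0P x y :
  hdot x y = 0 <-> rdot x y = 0 /\ rdot x ('i *: y) = 0.
Proof. by rewrite hdotE; split => [[-> ->]|[-> ->]]. Qed.

Lemma rdot_ext x x' : (forall y, rdot x y = rdot x' y) -> x = x'.
Proof.
move=> h; apply/eqP; rewrite -subr_eq0; apply/eqP/hnorm_eq0/eqP.
by rewrite -sqrf_eq0 hnorm_sqr rdotBl h subrr.
Qed.

Lemma hdot_ext x x' : (forall y, hdot x y = hdot x' y) -> x = x'.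
Proof. by move=> h; apply: rdot_ext => y; rewrite /rdot h. Qed.

Lemma hdot_extr x x' : (forall y, hdot y x = hdot y x') -> x = x'.
Proof. by move=> h; apply: hdot_ext => y; rewrite hdotC h -hdotC. Qed.

Lemma hnorm_ext x x' : (forall e, 0 < e -> hnorm (x - x') < e) -> x = x'.
Proof.
move=> h; apply/eqP; rewrite -subr_eq0; apply/eqP/hnorm_eq0.
by apply/eqP; rewrite eq_le hnorm_ge0 andbT; apply/ler_addgt0Pl => e /h /ltW;
  rewrite addr0.
Qed.

(** The test vector [y = x] recovers the norm. *)
Lemma hnorm_le_dual x C : 0 <= C ->
  (forall y, rdot x y <= C * hnorm y) -> hnorm x <= C.
Proof.
move=> C0 /(_ x); rewrite -hnorm_sqr expr2.
have [->|/hnorm_gt0 x0] := eqVneq x 0; first by rewrite hnorm0.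
by rewrite ler_pM2r.
Qed.

Lemma parallelogram x y :
  hnorm (x + y) ^+ 2 + hnorm (x - y) ^+ 2
  = 2 * hnorm x ^+ 2 + 2 * hnorm y ^+ 2.
Proof. by rewrite !hnorm_sqr !rdotE (rdotC y x); ring. Qed.

Definition hclosure (K : set H) : set H :=
  [set x | forall e : R, 0 < e -> exists2 y, K y & hnorm (x - y) < e].

Definition hclosed (K : set H) : Prop := hclosure K `<=` K.

Lemma sub_hclosure (K : set H) : K `<=` hclosure K.
Proof. by move=> x Kx e e0; exists x; rewrite ?subrr ?hnorm0. Qed.

Lemma ball_hnorm x y e : ball x e%:C y <-> hnorm (x - y) < e.
Proof. by rewrite -ball_normE /= normr_hnorm ltcR. Qed.

(** The norm has values in [R[i]], where a positive radius is a positive real. *)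
Lemma closureE (K : set H) : closure K = hclosure K.
Proof.
apply/seteqP; split => x.
  move=> clx e e0; have [|y [Ky /ball_hnorm ?]] := clx (ball x e%:C).
    by apply: nbhsx_ballx; rewrite ltcR.
  by exists y.
move=> clx B /nbhs_ballP[e /= e0 eB].
have e0' : 0 < complex.Re e by move: e0; rewrite ltcE => /andP[].
have [y Ky xy] := clx _ e0'; exists y; split=> //; apply: eB.
have -> : e = (complex.Re e)%:C by rewrite RRe_real // gtr0_real.
exact/ball_hnorm.
Qed.

Lemma dense_hnorm (D : set H) :
  (forall x e, 0 < e -> exists2 y, D y & hnorm (x - y) < e) -> dense D.
Proof.
move=> h O [x Ox] Oop; have : closure D x.
  by rewrite closureE => e e0; exact: h.
by rewrite setIC => /(_ O); apply; exact: open_nbhs_nbhs.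
Qed.

Lemma hilbert_filter_complete (F : set_system H) : ProperFilter F ->
  (forall e, 0 < e -> exists x, F [set y | hnorm (x - y) < e]) ->
  exists l, forall e, 0 < e -> F [set y | hnorm (l - y) < e].
Proof.
move=> FF Fc; have : cauchy F.
  apply/cauchyP => e e0.
  have e0' : 0 < complex.Re e by move: e0; rewrite ltcE => /andP[].
  have -> : e = (complex.Re e)%:C by rewrite RRe_real // gtr0_real.
  have [x Fx] := Fc _ e0'; exists x; apply: filterS Fx => y ?.
  exact/ball_hnorm.
move=> /cauchy_cvg/cvg_ex[l /fcvg_ballP Fl]; exists l => e e0.
have : F (ball l e%:C) by apply: Fl; rewrite ltcR.
by apply: filterS => y /ball_hnorm.
Qed.

Definition hlim (u : nat -> H) (l : H) : Prop :=
  forall e, 0 < e -> exists N, forall n, (N <= n)%N -> hnorm (u n - l) < e.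

Lemma hilbert_seq_complete (u : nat -> H) :
  (forall e, 0 < e -> exists N, forall n m, (N <= n)%N -> (N <= m)%N ->
     hnorm (u n - u m) < e) ->
  exists l, hlim u l.
Proof.
move=> uc.
have [|l hl] := @hilbert_filter_complete (u @ \oo) _.
  move=> e /uc [N hN]; exists (u N); exists N => //= n /= Nn; exact: hN.
exists l => e /hl [N _ hN]; exists N => n Nn.
by rewrite hdistC; exact: hN.
Qed.

Lemma hlim_closed (K : set H) u l :
  hclosed K -> (forall n, K (u n)) -> hlim u l -> K l.
Proof.
move=> Kc Ku ul; apply: Kc => e /ul [N hN]; exists (u N) => //.
by rewrite hdistC hN.
Qed.

End RealInnerProduct.

(** * Orthogonal projections and adjoints *)

Section ClosedSubspaces.
Context {R : realType} {H : hilbertSpace R}.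
Implicit Types (x y z : H) (K : set H) (T S : H -> H).

Definition real_subspace K : Prop :=
  [/\ K 0, forall x y, K x -> K y -> K (x + y)
    & forall (a : R) x, K x -> K (a%:C *: x)].

Definition csubspace K : Prop :=
  [/\ K 0, forall x y, K x -> K y -> K (x + y)
    & forall (c : R[i]) x, K x -> K (c *: x)].

(** The representing vector minimizes [|v|^2 - 2 f v] on [K]: by the parallelogram
    identity a minimizing sequence is Cauchy, and at the limit the first variation
    vanishes. With [f = rdot x] this is orthogonal projection, with [K] the whole
    space it gives adjoints. *)
Lemma riesz_closed K (f : H -> R) C : real_subspace K -> hclosed K ->
  (forall x y, f (x + y) = f x + f y) ->
  (forall (a : R) x, f (a%:C *: x) = a * f x) ->
  (forall x, `|f x| <= C * hnorm x) ->
  exists2 v, K v & forall k, K k -> f k = rdot v k.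
Proof.
move=> [K0 KD KZ] Kc fD fZ fC.
pose q v := hnorm v ^+ 2 - 2 * f v.
pose E := [set q v | v in K].
have Elb : has_inf E.
  split; first by exists (q 0), 0.
  exists (- C ^+ 2) => _ [v _ <-]; rewrite /q.
  have := sqr_ge0 (hnorm v - C); have := fC v; have := ler_norm (f v).
  nra.
pose m := inf E.
have qm v : K v -> m <= q v by move=> Kv; apply: ge_inf; [case: Elb|exists v].
have qE u v t : q (u + t%:C *: v)
    = q u + 2 * t * (rdot u v - f v) + t ^+ 2 * hnorm v ^+ 2.
  by rewrite /q !hnorm_sqr !rdotE fD fZ (rdotC v u); ring.
pose e n : R := n.+1%:R^-1.
have e0 n : 0 < e n by rewrite invr_gt0.
have eN n N : (N <= n)%N -> e n <= e N.
  by move=> Nn; rewrite lef_pV2 ?posrE // ler_nat.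
have esmall d : 0 < d -> exists N, e N < d.
  move=> d0; exists (Num.truncn d^-1); rewrite /e invf_plt ?posrE //.
  exact: truncnS_gt.
have /choice[u hu] : forall n, exists v, K v /\ q v < m + e n.
  move=> n; have [_ [v Kv <-] vm] := inf_adherent (e0 n) Elb.
  by exists v.
have udist n k : hnorm (u n - u k) ^+ 2 < 2 * (e n + e k).
  have [[Kn qn] [Kk qk]] := (hu n, hu k).
  have := qm _ (KZ (2^-1) _ (KD _ _ Kn Kk)); move: qn qk.
  rewrite /q !hnorm_sqr !rdotE fZ fD (rdotC (u k) (u n)); lra.
have [|v uv] := hilbert_seq_complete (u := u).
  move=> d d0; have /esmall[N eNd] : 0 < d ^+ 2 / 4 by rewrite divr_gt0 ?exprn_gt0.
  exists N => n k Nn Nk; rewrite -(@ltr_pXn2r _ 2) ?nnegrE ?hnorm_ge0 ?ltW //.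
  apply: lt_trans (udist n k) _; have := eN _ _ Nn; have := eN _ _ Nk; lra.
have Kv : K v by apply: hlim_closed uv => // n; case: (hu n).
exists v => // k Kk; apply/esym/eqP; rewrite -subr_eq0 -normr_eq0 eq_le normr_ge0.
rewrite andbT; apply/ler_addgt0Pl => d d0; rewrite addr0.
pose kk := hnorm k ^+ 2; have kk0 : 0 <= kk := sqr_ge0 _.
have [N1 hN1] : exists N, e N < (d / 2) ^+ 2 / (kk + 1).
  by apply: esmall; rewrite divr_gt0 ?exprn_gt0 ?divr_gt0 // ltr_wpDl.
have [N2 hN2] : exists N, forall n, (N <= n)%N ->
    hnorm (u n - v) < d / 2 / (hnorm k + 1).
  by apply: uv; rewrite !divr_gt0 // ltr_wpDl // hnorm_ge0.
pose n := maxn N1 N2; pose b := rdot (u n) k - f k.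
(* [q] at [u n] is within [e n] of its infimum; compare with the step [- b / (kk + 1)]
   along [k]. *)
have bk : b ^+ 2 <= e n * (kk + 1).
  have [Kn qn] := hu n.
  have := qm _ (KD _ _ Kn (KZ (- (b / (kk + 1))) _ Kk)).
  rewrite qE -/b -/kk => h.
  have {}h : 0 <= e n - 2 * (b / (kk + 1)) * b + (b / (kk + 1)) ^+ 2 * kk.
    by move: h qn; rewrite sqrrN; lra.
  have kk1 : 0 < kk + 1 by rewrite ltr_wpDl.
  rewrite -ler_pdivrMr //.
  have : (b / (kk + 1)) ^+ 2 * kk <= b ^+ 2 / (kk + 1).
    have -> : (b / (kk + 1)) ^+ 2 * kk = b ^+ 2 / (kk + 1) * (kk / (kk + 1)).
      by field; rewrite gt_eqF.
    rewrite ler_piMr //; first by rewrite divr_ge0 ?sqr_ge0 ?ltW.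
    by rewrite ler_pdivrMr // mul1r lerDl.
  move: h; have -> : 2 * (b / (kk + 1)) * b = 2 * (b ^+ 2 / (kk + 1)).
    by field; rewrite gt_eqF.
  by lra.
have bd : `|b| <= d / 2.
  rewrite -(@ler_pXn2r _ 2) ?nnegrE //; last by rewrite divr_ge0 // ltW.
  rewrite -normrX ger0_norm ?sqr_ge0 //.
  apply: le_trans bk _; rewrite -ler_pdivlMr ?ltr_wpDl //.
  by apply: le_trans (ltW hN1); apply: eN; exact: leq_maxl.
have -> : rdot v k - f k = b - rdot (u n - v) k.
  by rewrite /b rdotBl; ring.
apply: le_trans (ler_normB _ _) _.
have : `|rdot (u n - v) k| <= d / 2.
  apply: le_trans (norm_rdot_CS _ _) _.
  have := hN2 n (leq_maxr _ _); rewrite ltr_pdivlMr ?ltr_wpDl ?hnorm_ge0 //.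
  by have := hnorm_ge0 (u n - v); lra.
by lra.
Qed.

Lemma orth_projection K x : csubspace K -> hclosed K ->
  exists2 p, K p & forall k, K k -> hdot (x - p) k = 0.
Proof.
move=> [K0 KD KZ] Kc.
have [||||p Kp hp] := @riesz_closed K (rdot x) (hnorm x) _ Kc.
- by split=> // a y; exact: KZ.
- by move=> y z; rewrite rdotDr.
- by move=> a y; rewrite rdotZr.
- by move=> y; exact: norm_rdot_CS.
exists p => // k Kk; apply/hdot_eq0P; rewrite !rdotBl !hp ?subrr //.
exact: KZ.
Qed.

(** Defined for every set; it is the orthogonal projection when [K] is a closed
    complex subspace. *)
Definition hproj K x : H :=
  get [set p | K p /\ forall k, K k -> hdot (x - p) k = 0].

Lemma bopD T x y : bounded_op T -> T (x + y) = T x + T y.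
Proof. by move=> [Tl _]; rewrite -{1}[x]scale1r Tl scale1r. Qed.

Lemma bop0 T : bounded_op T -> T 0 = 0.
Proof. by move=> bT; apply: (addrI (T 0)); rewrite -bopD // !addr0. Qed.

Lemma bopZ T c x : bounded_op T -> T (c *: x) = c *: T x.
Proof. by move=> bT; have [Tl _] := bT; rewrite -[c *: x]addr0 Tl bop0 // addr0. Qed.

Lemma bopN T x : bounded_op T -> T (- x) = - T x.
Proof. by move=> bT; rewrite -scaleN1r bopZ // scaleN1r. Qed.

Lemma bopB T x y : bounded_op T -> T (x - y) = T x - T y.
Proof. by move=> bT; rewrite bopD // bopN. Qed.

Lemma bop_bound T : bounded_op T ->
  exists2 M, 0 <= M & forall x, hnorm (T x) <= M * hnorm x.
Proof.
move=> [_ [M hM]]; exists `|M| => // x; apply: le_trans (hM x) _.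
by rewrite ler_wpM2r ?hnorm_ge0 // ler_norm.
Qed.

Lemma bounded_opI T M : (forall x y, T (x + y) = T x + T y) ->
  (forall c x, T (c *: x) = c *: T x) ->
  (forall x, hnorm (T x) <= M * hnorm x) -> bounded_op T.
Proof. by move=> TD TZ TM; split; [move=> c x y; rewrite TD TZ|exists M]. Qed.

Lemma bop_comp T S : bounded_op T -> bounded_op S -> bounded_op (T \o S).
Proof.
move=> bT bS; have [M M0 hM] := bop_bound bT; have [N N0 hN] := bop_bound bS.
apply: (@bounded_opI _ (M * N)) => [x y|c x|x] /=.
- by rewrite (bopD _ _ bS) (bopD _ _ bT).
- by rewrite (bopZ _ _ bS) (bopZ _ _ bT).
- by apply: le_trans (hM _) _; rewrite -mulrA ler_wpM2l.
Qed.

Lemma bop_add T S : bounded_op T -> bounded_op S ->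
  bounded_op (fun x => T x + S x).
Proof.
move=> bT bS; have [M M0 hM] := bop_bound bT; have [N N0 hN] := bop_bound bS.
apply: (@bounded_opI _ (M + N)) => [x y|c x|x] /=.
- by rewrite (bopD _ _ bT) (bopD _ _ bS) addrACA.
- by rewrite (bopZ _ _ bT) (bopZ _ _ bS) scalerDr.
- by rewrite mulrDl; apply: (le_trans (hnorm_leD _ _)); rewrite lerD.
Qed.

Lemma bop_scale c T : bounded_op T -> bounded_op (fun x => c *: T x).
Proof.
move=> bT; have [M M0 hM] := bop_bound bT.
apply: (@bounded_opI _ (complex.Re `|c| * M)) => [x y|d x|x] /=.
- by rewrite (bopD _ _ bT) scalerDr.
- by rewrite (bopZ _ _ bT) !scalerA mulrC.
- rewrite hnormZ -mulrA ler_wpM2l //.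
  by have := normr_ge0 c; rewrite lecE => /andP[].
Qed.

Lemma bop_id : bounded_op (@id H).
Proof. by apply: (@bounded_opI _ 1) => // x; rewrite mul1r. Qed.

Lemma bop_zero : bounded_op (fun _ : H => 0 : H).
Proof.
apply: (@bounded_opI _ 0) => [x y|c x|x]; rewrite ?addr0 ?scaler0 //.
by rewrite hnorm0 mul0r.
Qed.

Lemma bop_sub T S : bounded_op T -> bounded_op S ->
  bounded_op (fun x => T x - S x).
Proof.
move=> bT bS; have := bop_add bT (bop_scale (-1) bS).
by congr bounded_op; apply/funext => x; rewrite scaleN1r.
Qed.

Lemma adjoint_exists T : bounded_op T ->
  exists2 S, bounded_op S & adjoint T S.
Proof.
move=> bT; have [M M0 hM] := bop_bound bT.
have /choice[S hS] : forall y, exists v, forall x, hdot (T x) y = hdot x v.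
  move=> y.
  have [|||||v _ hv] := @riesz_closed setT (fun x => rdot (T x) y) (M * hnorm y).
  - by split.
  - by [].
  - by move=> u v; rewrite (bopD _ _ bT) rdotDl.
  - by move=> a u; rewrite (bopZ _ _ bT) rdotZl.
  - move=> u; apply: le_trans (norm_rdot_CS _ _) _.
    by rewrite mulrAC ler_wpM2r ?hnorm_ge0.
  exists v => x; rewrite !hdotE hv // (rdotC v); congr (_ +i* _).
  have h := rdot_i (T x) y; rewrite -(bopZ _ _ bT) hv // in h.
  by apply: oppr_inj; rewrite -h (rdotC v) rdot_i.
have adj : adjoint T S by move=> x y; exact: hS.
exists S => //; apply: (@bounded_opI _ M) => [x y|c x|x].
- by apply: hdot_extr => z; rewrite -hS !hdotDr -!hS.
- by apply: hdot_extr => z; rewrite -hS !hdotZr -!hS.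
- apply: hnorm_le_dual => [|y]; first by rewrite mulr_ge0 ?hnorm_ge0.
  rewrite rdotC /rdot -hS; apply: le_trans (rdot_CS _ _) _.
  by rewrite mulrAC ler_wpM2r ?hnorm_ge0.
Qed.

Lemma adjointC T S : adjoint T S -> adjoint S T.
Proof. by move=> h x y; rewrite hdotC -h -hdotC. Qed.

Lemma adjoint_uniq T S S' : adjoint T S -> adjoint T S' -> S = S'.
Proof. by move=> h h'; apply/funext => y; apply: hdot_extr => x; rewrite -h h'. Qed.

Lemma adjoint_rdot T S x y : adjoint T S -> rdot (T x) y = rdot x (S y).
Proof. by move=> h; rewrite /rdot h. Qed.

Section Projection.
Variables (K : set H) (csK : csubspace K) (clK : hclosed K).

Lemma hprojP x : K (hproj K x) /\ forall k, K k -> hdot (x - hproj K x) k = 0.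
Proof.
apply: (@getPex _ [set p | K p /\ forall k, K k -> hdot (x - p) k = 0]).
by have [p Kp hp] := orth_projection x csK clK; exists p.
Qed.

Lemma hproj_in x : K (hproj K x). Proof. by case: (hprojP x). Qed.

Lemma hproj_orth x k : K k -> hdot (x - hproj K x) k = 0.
Proof. by case: (hprojP x) => _; exact. Qed.

Lemma hprojE x p : K p -> (forall k, K k -> hdot (x - p) k = 0) -> hproj K x = p.
Proof.
move=> Kp hp; have [K0 KD KZ] := csK.
have Kd : K (hproj K x - p).
  by apply: KD; [exact: hproj_in|rewrite -scaleN1r; exact: KZ].
apply/eqP; rewrite -subr_eq0; apply/eqP/hnorm_eq0/eqP.
rewrite -sqrf_eq0 hnorm_sqr /rdot.
have e : hproj K x - p = (x - p) - (x - hproj K x).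
  by rewrite opprB [RHS]addrC addrA subrK.
by rewrite {1}e hdotBl hp // hproj_orth // subrr.
Qed.

Lemma hproj_id x : K x -> hproj K x = x.
Proof. by move=> Kx; apply: hprojE => // k _; rewrite subrr hdot0l. Qed.

Lemma hproj_perp x : (forall k, K k -> hdot x k = 0) -> hproj K x = 0.
Proof. by move=> h; apply: hprojE => [|k /h]; [case: csK|rewrite subr0]. Qed.

Lemma hprojD x y : hproj K (x + y) = hproj K x + hproj K y.
Proof.
have [K0 KD KZ] := csK.
apply: hprojE => [|k Kk]; first by apply: KD; exact: hproj_in.
by rewrite opprD addrACA hdotDl !hproj_orth ?addr0.
Qed.

Lemma hprojZ c x : hproj K (c *: x) = c *: hproj K x.
Proof.
have [K0 KD KZ] := csK.
apply: hprojE => [|k Kk]; first by apply: KZ; exact: hproj_in.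
by rewrite -scalerBr hdotZl hproj_orth ?mulr0.
Qed.

Lemma hproj_adj : adjoint (hproj K) (hproj K).
Proof.
move=> x y.
have e1 : hdot (hproj K x) y = hdot (hproj K x) (hproj K y).
  apply/eqP; rewrite -subr_eq0 -hdotBr hdotC hproj_orth ?conjc0 //.
  exact: hproj_in.
have e2 : hdot x (hproj K y) = hdot (hproj K x) (hproj K y).
  by apply/eqP; rewrite -subr_eq0 -hdotBl hproj_orth //; exact: hproj_in.
by rewrite e1 e2.
Qed.

Lemma hproj_idem x : hproj K (hproj K x) = hproj K x.
Proof. exact/hproj_id/hproj_in. Qed.

Lemma hproj_norm x : hnorm (hproj K x) <= hnorm x.
Proof.
have [->|/hnorm_gt0 n0] := eqVneq (hproj K x) 0; first by rewrite hnorm0 hnorm_ge0.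
rewrite -(ler_pM2r n0) -expr2 hnorm_sqr (adjoint_rdot _ _ hproj_adj) hproj_idem.
exact: rdot_CS.
Qed.

Lemma hproj_bounded : bounded_op (hproj K).
Proof.
apply: (@bounded_opI _ 1); [exact: hprojD|exact: hprojZ|].
by move=> x; rewrite mul1r hproj_norm.
Qed.

Lemma hproj_projection : projection (hproj K).
Proof.
by split; [exact: hproj_bounded|apply/funext/hproj_idem|exact: hproj_adj].
Qed.

Lemma hproj_commute T S : bounded_op T -> adjoint T S ->
  (forall x, K x -> K (T x)) -> (forall x, K x -> K (S x)) ->
  T \o hproj K = hproj K \o T.
Proof.
move=> bT TS KT KS; apply/funext => x /=; apply/esym/hprojE.
  by apply: KT; exact: hproj_in.
by move=> k Kk; rewrite -(bopB _ _ bT) TS hproj_orth //; exact: KS.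
Qed.

End Projection.

Lemma hclosure_csubspace K : csubspace K -> csubspace (hclosure K).
Proof.
move=> [K0 KD KZ]; split; first exact: sub_hclosure.
- move=> x y Kx Ky e e0; have e2 : 0 < e / 2 by rewrite divr_gt0.
  have [[x' Kx' xx'] [y' Ky' yy']] := (Kx _ e2, Ky _ e2).
  exists (x' + y'); first exact: KD.
  rewrite opprD addrACA; apply: le_lt_trans (hnorm_leD _ _) _; lra.
- move=> c x Kx e e0; pose d := complex.Re `|c| + 1.
  have c0 : 0 <= complex.Re `|c| by have := normr_ge0 c; rewrite lecE => /andP[].
  have d0 : 0 < d by rewrite /d; lra.
  have [x' Kx' xx'] := Kx _ (divr_gt0 e0 d0).
  exists (c *: x'); first exact: KZ.
  rewrite -scalerBr hnormZ; move: xx'; rewrite ltr_pdivlMr // /d mulrDr mulr1.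
  by rewrite mulrC; apply: le_lt_trans; rewrite lerDl hnorm_ge0.
Qed.

Lemma hclosure_closed K : hclosed (hclosure K).
Proof.
move=> x Kx e e0; have e2 : 0 < e / 2 by rewrite divr_gt0.
have [y Ky xy] := Kx _ e2; have [z Kz yz] := Ky _ e2.
exists z => //; have -> : x - z = (x - y) + (y - z) by rewrite addrA subrK.
apply: le_lt_trans (hnorm_leD _ _) _; lra.
Qed.

Lemma hclosure_invariant K T : bounded_op T -> (forall x, K x -> K (T x)) ->
  forall x, hclosure K x -> hclosure K (T x).
Proof.
move=> bT KT x Kx e e0; have [M M0 hM] := bop_bound bT.
have M1 : 0 < M + 1 by rewrite ltr_wpDl.
have [y Ky xy] := Kx _ (divr_gt0 e0 M1).
exists (T y); first exact: KT.
rewrite -(bopB _ _ bT); apply: le_lt_trans (hM _) _; move: xy.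
rewrite ltr_pdivlMr // mulrDr mulr1 mulrC; apply: le_lt_trans.
by rewrite lerDl hnorm_ge0.
Qed.

Lemma orthogonal_hclosure K y : (forall x, K x -> hdot x y = 0) ->
  forall x, hclosure K x -> hdot x y = 0.
Proof.
have aux : forall (y' : H), (forall x, K x -> rdot x y' = 0) ->
    forall x, hclosure K x -> rdot x y' = 0.
  move=> y' h x Kx; apply/eqP; rewrite -normr_eq0 eq_le normr_ge0 andbT.
  apply/ler_addgt0Pl => e e0; rewrite addr0.
  have y1 : 0 < hnorm y' + 1 by rewrite ltr_wpDl ?hnorm_ge0.
  have [z Kz xz] := Kx _ (divr_gt0 e0 y1).
  have -> : rdot x y' = rdot (x - z) y' by rewrite rdotBl (h z) ?subr0.
  apply: le_trans (norm_rdot_CS _ _) _; move: xz; rewrite ltr_pdivlMr //.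
  by have := hnorm_ge0 (x - z); lra.
move=> h x Kx; apply/hdot_eq0P; split; apply: aux => // z /h /hdot_eq0P[] //.
Qed.

End ClosedSubspaces.

(** * Commutants and von Neumann algebras *)

Section VonNeumannAlgebras.
Context {R : realType} {H : hilbertSpace R}.
Implicit Types (T S Q f : H -> H) (A B F : set (H -> H)) (x y : H).

Lemma vN_subspace A : von_neumann_algebra A -> op_subspace A.
Proof. by case=> [[]]. Qed.

Lemma vN_bounded A : von_neumann_algebra A -> A `<=` bounded_op.
Proof. by move/vN_subspace => []. Qed.

Lemma vN_bicommutant A : von_neumann_algebra A -> commutant (commutant A) = A.
Proof. by case. Qed.

Lemma commutant_bounded F : commutant F `<=` bounded_op.
Proof. by move=> T []. Qed.

Lemma commutantS F B : F `<=` B -> commutant B `<=` commutant F.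
Proof. by move=> FB T [bT cT]; split=> // S /FB/cT. Qed.

Lemma sub_bicommutant F : F `<=` bounded_op -> F `<=` commutant (commutant F).
Proof. by move=> Fb T FT; split=> [|S [_ /(_ _ FT)]]; [exact: Fb|]. Qed.

Lemma commutant3 F : F `<=` bounded_op ->
  commutant (commutant (commutant F)) = commutant F.
Proof.
move=> Fb; apply/seteqP; split; first exact/commutantS/sub_bicommutant.
exact/sub_bicommutant/commutant_bounded.
Qed.

Definition selfadjoint_set F : Prop :=
  forall T S, F T -> bounded_op S -> adjoint T S -> F S.

Lemma vN_selfadjoint A : von_neumann_algebra A -> selfadjoint_set A.
Proof. by case=> [[_ _ _ ?] _]. Qed.

(** Closure under adjoints comes from that of [F], the bicommutant condition from the
    identity [F''' = F']. *)
Lemma commutant_vN F : F `<=` bounded_op -> selfadjoint_set F ->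
  von_neumann_algebra (commutant F).
Proof.
move=> Fb Fs; split; last exact: commutant3.
split.
- split; first exact: commutant_bounded.
  + split; first exact: bop_zero.
    by move=> S /Fb bS; apply/funext => x /=; rewrite (bop0 bS).
  + move=> T S [bT cT] [bS cS]; split; first exact: bop_add.
    move=> f Ff; apply/funext => x /=; rewrite (bopD _ _ (Fb _ Ff)).
    by have /(congr1 (@^~ x)) /= -> := cT _ Ff;
      have /(congr1 (@^~ x)) /= -> := cS _ Ff.
  + move=> c T [bT cT]; split; first exact: bop_scale.
    move=> f Ff; apply/funext => x /=; rewrite (bopZ _ _ (Fb _ Ff)).
    by have /(congr1 (@^~ x)) /= -> := cT _ Ff.
- by split; first exact: bop_id.
- move=> T S [bT cT] [bS cS]; split; first exact: bop_comp.
  by move=> f Ff; rewrite -compA (cS _ Ff) compA (cT _ Ff) compA.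
- move=> T S [bT cT] bS TS; split=> // f Ff.
  have [g bg fg] := adjoint_exists (Fb _ Ff).
  have /cT Tg := Fs _ _ Ff bg fg.
  apply/funext => x; apply: hdot_extr => y /=.
  have /(congr1 (@^~ y)) /= e := Tg.
  by rewrite -TS -(adjointC fg) -e TS (adjointC fg).
Qed.

Lemma vN_commutant A : von_neumann_algebra A -> von_neumann_algebra (commutant A).
Proof. by move=> vA; apply: commutant_vN; [exact: vN_bounded|exact: vN_selfadjoint]. Qed.

Lemma bounded_op_vN : von_neumann_algebra (@bounded_op R H).
Proof.
have -> : @bounded_op R H = commutant [set id].
  by apply/seteqP; split=> [T bT|T []] //; split=> // S ->.
apply: commutant_vN => [T ->|T S -> bS h]; first exact: bop_id.
by apply/funext => x; apply: hdot_extr => y; rewrite -h.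
Qed.

Lemma sub_vN_generated F : F `<=` vN_generated F.
Proof. by move=> T FT B _; apply. Qed.

(** Intersecting von Neumann algebras preserves the bicommutant condition because
    taking bicommutants is monotone. *)
Lemma vN_generated_vN F : F `<=` bounded_op -> von_neumann_algebra (vN_generated F).
Proof.
move=> Fb; have gb : vN_generated F `<=` bounded_op.
  by move=> T; apply=> //; exact: bounded_op_vN.
split.
- split; first split=> //.
  + by move=> B vB FB; case: (vN_subspace vB).
  + move=> T S gT gS B vB FB; case: (vN_subspace vB) => _ _ D _.
    by apply: D; [exact: gT|exact: gS].
  + move=> c T gT B vB FB; case: (vN_subspace vB) => _ _ _ Z.
    by apply: Z; exact: gT.
  + by move=> B [[_ ? _ _] _] _.
  + move=> T S gT gS B vB FB; have [[_ _ M _] _] := vB.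
    by apply: M; [exact: gT|exact: gS].
  + move=> T S gT bS TS B vB FB; have [[_ _ _ M] _] := vB.
    exact: M (gT _ vB FB) bS TS.
- apply/seteqP; split; last exact: sub_bicommutant.
  move=> T ccT B vB FB; rewrite -(vN_bicommutant vB).
  by move: T ccT; do 2!apply: commutantS; move=> T; apply.
Qed.

Lemma projection_bounded Q : projection Q -> bounded_op Q.
Proof. by case. Qed.

Lemma projections_selfadjoint F : F `<=` projection -> selfadjoint_set F.
Proof.
move=> Fp T S FT bS TS; have [_ _ TT] := Fp _ FT.
by rewrite (adjoint_uniq TS TT).
Qed.

Lemma commutant_projections_vN F :
  F `<=` projection -> von_neumann_algebra (commutant F).
Proof.
move=> Fp; apply: commutant_vN; last exact: projections_selfadjoint.
by move=> T /Fp/projection_bounded.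
Qed.

Lemma bigcap_commutant n (Q : 'I_n -> H -> H) : (0 < n)%N ->
  \bigcap_(i in [set: 'I_n]) commutant [set Q i] = commutant (range Q).
Proof.
move=> n0; apply/seteqP; split=> T.
  move=> h; split; first by case: (h (Ordinal n0) I).
  by move=> _ [i _ <-]; case: (h i I) => _; exact.
by move=> [bT cT] i _; split=> // S ->; apply: cT; exists i.
Qed.

End VonNeumannAlgebras.

(** * Hyperreflexivity as a distance estimate *)

Section DistanceEstimates.
Context {R : realType} {H : hilbertSpace R}.
Implicit Types (T S : H -> H) (A X : set (H -> H)) (x y : H).

(** Rotating a vector by a phase turns the modulus of an inner product into its
    real part, so all estimates can be made with [rdot]. *)
Lemma complex_phase (z : R[i]) : exists2 u : R[i], `|u| = 1 & u * z = `|z|.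
Proof.
have [->|z0] := eqVneq z 0; first by exists 1; rewrite ?normr1 ?mulr0 ?normr0.
exists (`|z| / z); last by rewrite divfK.
by rewrite normrM normr_id normfV divff // normr_eq0.
Qed.

Lemma hdot_CS x y : complex.Re `|hdot x y| <= hnorm x * hnorm y.
Proof.
have [u u1 e] := complex_phase (hdot x y).
rewrite -e -hdotZl; apply: le_trans (rdot_CS _ _) _.
by rewrite hnormZ u1 mul1r.
Qed.

Lemma rdot_le_hdot x y : rdot x y <= complex.Re `|hdot x y|.
Proof.
by have := normc_ge_Re (hdot x y); rewrite lecE => /andP[_]; apply/le_trans/ler_norm.
Qed.

(** The rank-one functional [S |-> <S x, y>] annihilates [X]. *)
Definition ann X x y : Prop := forall S, X S -> hdot (S x) y = 0.

Definition rank_one_bound X T (c : R) : Prop :=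
  forall x y, ann X x y -> rdot (T x) y <= c * hnorm x * hnorm y.

(** The inequality [d(T, X) <= k r_X(T)] with the supremum and the infimum unfolded;
    [d] is strictly larger than [k c] since the distance need not be attained. *)
Definition distance_estimate X (k : R) : Prop :=
  forall T c, bounded_op T -> 0 <= c -> rank_one_bound X T c ->
  forall d, k * c < d -> exists2 S, X S & forall x, hnorm (T x - S x) <= d * hnorm x.

Lemma opnorm_le T C : 0 <= C -> (forall x, hnorm (T x) <= C * hnorm x) ->
  opnorm T <= C.
Proof.
move=> C0 h; apply: ge_sup => [|_ [x /= x1 <-]].
  by exists (hnorm (T 0)), 0 => //=; rewrite hnorm0.
by apply: le_trans (h x) _; rewrite ler_piMr.
Qed.

Lemma le_opnorm T x : bounded_op T -> hnorm (T x) <= opnorm T * hnorm x.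
Proof.
move=> bT; have [M M0 hM] := bop_bound bT.
have hs : has_ubound [set hnorm (T x) | x in [set x | hnorm x <= 1]].
  exists M => _ [y /= y1 <-]; apply: le_trans (hM y) _.
  by rewrite ler_piMr.
have [->|/hnorm_gt0 x0] := eqVneq x 0; first by rewrite (bop0 bT) hnorm0 mulr0.
have : hnorm (T ((hnorm x)^-1%:C *: x)) <= opnorm T.
  apply: ub_le_sup => //; exists ((hnorm x)^-1%:C *: x) => //.
  by rewrite /= hnormZr ger0_norm ?invr_ge0 ?(ltW x0) // mulVf ?gt_eqF.
rewrite (bopZ _ _ bT) hnormZr ger0_norm ?invr_ge0 ?(ltW x0) //.
by rewrite ler_pdivrMl // mulrC.
Qed.

Lemma annZ X c x y : X `<=` bounded_op -> ann X x y -> ann X (c *: x) y.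
Proof. by move=> Xb h S XS; rewrite (bopZ _ _ (Xb _ XS)) hdotZl h ?mulr0. Qed.

Lemma annZr X c x y : ann X x y -> ann X x (c *: y).
Proof. by move=> h S XS; rewrite hdotZr h ?mulr0. Qed.

Lemma rank_one_bound_norm X T c x y : X `<=` bounded_op -> bounded_op T ->
  rank_one_bound X T c -> ann X x y ->
  complex.Re `|hdot (T x) y| <= c * hnorm x * hnorm y.
Proof.
move=> Xb bT h a; have [u u1 <-] := complex_phase (hdot (T x) y).
rewrite -hdotZl -(bopZ _ _ bT); apply: le_trans (h _ _ (annZ _ _ a)) _ => //.
by rewrite hnormZ u1 mul1r.
Qed.

(** [0 <= c] is needed because the supremum of the empty set is 0. *)
Lemma sup_le_nonneg (E : set R) c : 0 <= c -> ubound E c -> sup E <= c.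
Proof.
move=> c0 Ec; have [->|E0] := eqVneq E set0; first by rewrite sup0.
by apply: ge_sup => //; exact/set0P.
Qed.

Lemma sup_nonneg (E : set R) : (forall e, E e -> 0 <= e) -> 0 <= sup E.
Proof.
move=> E0; have [[[e Ee] Eub]|] := pselect (has_sup E); last by move/sup_out ->.
by apply: le_trans (E0 _ Ee) _; apply: ub_le_sup.
Qed.

Lemma hyperreflexive_distance_estimate X : hyperreflexive X ->
  exists2 k, 0 < k & distance_estimate X k.
Proof.
move=> [[Xs _] [k k0 hk]]; exists k => // T c bT c0 hc d kcd.
have [Xb X0 _ _] := Xs.
have rc : seminorm_r X T <= c.
  apply: sup_le_nonneg => // _ [x [y [x1 y1 a ->]]].
  have := rank_one_bound_norm Xb bT hc a.
  by rewrite x1 y1 !mulr1.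
have Tc : op_dist T X < d.
  apply: le_lt_trans (hk _ bT) _; apply: le_lt_trans kcd.
  by rewrite ler_pM2l.
have [|_ [S XS <-] Sd] := @inf_lt _ _ d _ Tc.
- by exists (opnorm (fun x => T x - 0)), (fun=> 0).
- by exists S => // x; have bS := Xb _ XS;
    apply: le_trans (le_opnorm x (bop_sub bT bS)) _;
    rewrite ler_wpM2r ?hnorm_ge0 // ltW.
Qed.

Lemma seminorm_r_bound X T : X `<=` bounded_op -> bounded_op T ->
  rank_one_bound X T (seminorm_r X T).
Proof.
move=> Xb bT x y a.
have [->|x0] := eqVneq x 0; first by rewrite (bop0 bT) rdot0l hnorm0 mulr0 mul0r.
have [->|y0] := eqVneq y 0; first by rewrite rdot0r hnorm0 mulr0.
move: x0 y0 => /hnorm_gt0 x0 /hnorm_gt0 y0.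
have [M M0 hM] := bop_bound bT.
pose x' := (hnorm x)^-1%:C *: x; pose y' := (hnorm y)^-1%:C *: y.
have x1 : hnorm x' = 1.
  by rewrite hnormZr ger0_norm ?invr_ge0 ?(ltW x0) // mulVf ?gt_eqF.
have y1 : hnorm y' = 1.
  by rewrite hnormZr ger0_norm ?invr_ge0 ?(ltW y0) // mulVf ?gt_eqF.
have : complex.Re `|hdot (T x') y'| <= seminorm_r X T.
  apply: ub_le_sup.
    exists M => _ [u [v [u1 v1 _ ->]]]; apply: le_trans (hdot_CS _ _) _.
    by rewrite v1 mulr1; apply: le_trans (hM _) _; rewrite u1 mulr1.
  exists x', y'; split=> //.
  by apply: annZr; exact: annZ.
move=> /(le_trans (rdot_le_hdot _ _)).
rewrite /x' /y' (bopZ _ _ bT) rdotZl rdotZr mulrA -invfM.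
by rewrite ler_pdivrMl ?mulr_gt0 // -mulrA mulrC.
Qed.

Lemma ann_closure X T x y : (closure [set S x | S in X] (T x)) -> ann X x y ->
  hdot (T x) y = 0.
Proof.
by rewrite closureE => Tx a; apply: orthogonal_hclosure Tx => _ [S XS <-]; exact: a.
Qed.

(** Commuting with [f] is a norm-closed condition. *)
Lemma commutant_norm_closed X T : X `<=` bounded_op -> bounded_op T ->
  (forall d, 0 < d -> exists2 S, commutant X S &
     forall x, hnorm (T x - S x) <= d * hnorm x) -> commutant X T.
Proof.
move=> Xb bT h; split=> // f Xf; have bf := Xb _ Xf.
have [M M0 hM] := bop_bound bf.
apply/funext => x /=; apply: hnorm_ext => e e0.
pose D := 2 * (M + 1) * (hnorm x + 1).
have D0 : 0 < D by rewrite /D !mulr_gt0 // ltr_wpDl // hnorm_ge0.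
have [S [bS cS] hS] := h _ (divr_gt0 e0 D0).
have -> : T (f x) - f (T x) = (T (f x) - S (f x)) - f (T x - S x).
  have /(congr1 (@^~ x)) /= -> := cS _ Xf.
  by rewrite (bopB _ _ bf) opprB addrA subrK.
apply: le_lt_trans (hnorm_leB _ _) _.
have h1 := hS (f x); have h2 := hM (T x - S x); have h3 := hS x; have h4 := hM x.
have x0 := hnorm_ge0 x; have p0 : 0 < e / D by exact: divr_gt0.
set p := e / D in h1 h3 p0.
have -> : e = p * D by rewrite /p divfK ?gt_eqF.
have h5 : p * hnorm (f x) <= p * (M * hnorm x) by rewrite ler_pM2l.
have h6 : M * hnorm (T x - S x) <= M * (p * hnorm x) by rewrite ler_wpM2l.
apply: (@le_lt_trans _ _ (2 * (p * (M * hnorm x)))); first by lra.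
have -> : p * D = 2 * (p * ((M + 1) * (hnorm x + 1))) by rewrite /D; ring.
rewrite ltr_pM2l // ltr_pM2l //.
have := mulr_ge0 M0 x0; lra.
Qed.

(** Reflexivity comes for free: if [T x] is in the closure of [X x] for all [x], then
    every rank-one functional annihilating [X] annihilates [T], so [T] has distance 0
    to [X], which is norm closed. *)
Lemma distance_estimate_hyperreflexive X : von_neumann_algebra X ->
  (exists2 k, 0 < k & distance_estimate X k) -> hyperreflexive X.
Proof.
move=> vX [k k0 hk]; have Xb := vN_bounded vX; split.
  split; first exact: vN_subspace.
  move=> T bT hT; rewrite -(vN_bicommutant vX).
  apply: commutant_norm_closed => // [S []//|d d0].
  have [||S XS hS] := hk T 0 bT (lexx _) _ d; last 1 first.
  - by exists S => //; exact: sub_bicommutant.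
  - move=> x y a; rewrite /rdot (ann_closure (hT x) a) /=.
    by rewrite !mul0r.
  - by rewrite mulr0.
exists k => // T bT; apply/ler_addgt0Pl => e e0.
have r0 : 0 <= seminorm_r X T.
  by apply: sup_nonneg => _ [x [y [_ _ _ ->]]];
    have := normr_ge0 (hdot (T x) y); rewrite lecE => /andP[].
have [|S XS hS] := hk T _ bT r0 (seminorm_r_bound Xb bT)
  (e + k * seminorm_r X T).
  by rewrite ltrDr.
apply: (@le_trans _ _ (opnorm (fun x => T x - S x))).
  apply: ge_inf; last by exists S.
  exists 0 => _ [S' _ <-]; apply: sup_nonneg => _ [x _ <-]; exact: hnorm_ge0.
apply: opnorm_le => //.
by rewrite addr_ge0 ?(ltW e0) ?mulr_ge0 ?(ltW k0).
Qed.

End DistanceEstimates.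

(** * Direct squares and closed subspaces as Hilbert spaces *)

Section DirectSquare.
Context {R : realType} (H : hilbertSpace R).

Definition square_ip (u v : (H * H)%type) : R[i] :=
  hdot u.1 v.1 + hdot u.2 v.2.

Lemma square_re_ip u : re_ip square_ip u u = rdot u.1 u.1 + rdot u.2 u.2.
Proof.
by rewrite /re_ip /square_ip /rdot; case: (hdot u.1 u.1) (hdot u.2 u.2) => ? ? [].
Qed.

Lemma square_ip_inner : inner_product square_ip.
Proof.
split=> [c x y z|x y|[x y] xy0]; rewrite /square_ip /=.
- by rewrite !linearPl mulrDr addrACA.
- by rewrite rmorphD /= (hdotC x.1) (hdotC x.2).
- have pos (z : H) : 0 <= hdot z z by rewrite -hdot_norm exprn_ge0.
  have [x0|x0] := eqVneq x 0; last by rewrite ltr_wpDr ?neq0_dnorm_gt0.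
  rewrite ltr_wpDl ?neq0_dnorm_gt0 //; apply: contra xy0 => /eqP ->.
  by rewrite x0.
Qed.

Lemma square_ip_norm u : ip_norm square_ip u ^+ 2 = hnorm u.1 ^+ 2 + hnorm u.2 ^+ 2.
Proof. by rewrite (ip_norm_sqr square_ip_inner) square_re_ip -!hnorm_sqr. Qed.

Lemma le_norm_of_sqr (a b c : R) : 0 <= a -> 0 <= c ->
  a ^+ 2 + b = c ^+ 2 -> 0 <= b -> a <= c.
Proof. by move=> a0 c0 e b0; rewrite -(@ler_pXn2r _ 2) ?nnegrE // -e lerDl. Qed.

(** Both coordinates of a Cauchy filter are Cauchy. *)
Lemma square_ip_complete : ip_complete square_ip.
Proof.
move=> F FF Fc.
have fst_le u : hnorm u.1 <= ip_norm square_ip u.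
  apply: (@le_norm_of_sqr _ (hnorm u.2 ^+ 2)); rewrite ?ip_norm_ge0 ?hnorm_ge0 ?sqr_ge0 //.
  by rewrite square_ip_norm.
have snd_le u : hnorm u.2 <= ip_norm square_ip u.
  apply: (@le_norm_of_sqr _ (hnorm u.1 ^+ 2)); rewrite ?ip_norm_ge0 ?hnorm_ge0 ?sqr_ge0 //.
  by rewrite square_ip_norm addrC.
have le_sum u : ip_norm square_ip u <= hnorm u.1 + hnorm u.2.
  rewrite -(@ler_pXn2r _ 2) ?nnegrE ?ip_norm_ge0 ?addr_ge0 ?hnorm_ge0 //.
  rewrite square_ip_norm; have := hnorm_ge0 u.1; have := hnorm_ge0 u.2; nra.
have [|l1 hl1] := @hilbert_filter_complete R H (fst @ F) _.
  move=> e /Fc[x Fx]; exists x.1; change (F [set u | hnorm (x.1 - u.1) < e]); apply: filterS Fx => y /=; apply: le_lt_trans.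
  exact: (fst_le (x - y)).
have [|l2 hl2] := @hilbert_filter_complete R H (snd @ F) _.
  move=> e /Fc[x Fx]; exists x.2; change (F [set u | hnorm (x.2 - u.2) < e]); apply: filterS Fx => y /=; apply: le_lt_trans.
  exact: (snd_le (x - y)).
exists (l1, l2) => e e0; have e2 : 0 < e / 2 by rewrite divr_gt0.
have h1 : F [set u | hnorm (l1 - u.1) < e / 2] := hl1 _ e2.
have h2 : F [set u | hnorm (l2 - u.2) < e / 2] := hl2 _ e2.
apply: filterS2 h1 h2 => y y1 y2.
apply: le_lt_trans (le_sum _) _; rewrite /=.
by rewrite [ltRHS](splitr e) ltrD.
Qed.

Definition hsquare : hilbertSpace R :=
  hilbert_of_ip square_ip_inner square_ip_complete.

Definition hpair (x y : H) : hsquare := (x, y).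
Definition hfst (u : hsquare) : H := u.1.
Definition hsnd (u : hsquare) : H := u.2.

Lemma hfst_pair x y : hfst (hpair x y) = x. Proof. by []. Qed.
Lemma hsnd_pair x y : hsnd (hpair x y) = y. Proof. by []. Qed.
Lemma hpair_eta u : hpair (hfst u) (hsnd u) = u. Proof. by case: u. Qed.
Lemma hfstD u v : hfst (u + v) = hfst u + hfst v. Proof. by []. Qed.
Lemma hsndD u v : hsnd (u + v) = hsnd u + hsnd v. Proof. by []. Qed.
Lemma hfstB u v : hfst (u - v) = hfst u - hfst v. Proof. by []. Qed.
Lemma hsndB u v : hsnd (u - v) = hsnd u - hsnd v. Proof. by []. Qed.
Lemma hfstZ c u : hfst (c *: u) = c *: hfst u. Proof. by []. Qed.
Lemma hsndZ c u : hsnd (c *: u) = c *: hsnd u. Proof. by []. Qed.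
Lemma hpairD x y x' y' : hpair x y + hpair x' y' = hpair (x + x') (y + y').
Proof. by []. Qed.
Lemma hpairZ c x y : c *: hpair x y = hpair (c *: x) (c *: y).
Proof. by []. Qed.

Lemma hdot_square u v :
  hdot u v = hdot (hfst u) (hfst v) + hdot (hsnd u) (hsnd v).
Proof. by []. Qed.

Lemma rdot_square u v :
  rdot u v = rdot (hfst u) (hfst v) + rdot (hsnd u) (hsnd v).
Proof.
rewrite /rdot hdot_square.
by case: (hdot (hfst u) (hfst v)) (hdot (hsnd u) (hsnd v)) => ? ? [].
Qed.

Lemma hnorm_square u : hnorm u ^+ 2 = hnorm (hfst u) ^+ 2 + hnorm (hsnd u) ^+ 2.
Proof. by rewrite !hnorm_sqr rdot_square. Qed.

End DirectSquare.

Section ClosedSubspace.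
Context {R : realType} {H : hilbertSpace R} (K : set H).
Hypotheses (csK : csubspace K) (clK : hclosed K).

(** The proof [csK] is an argument so that the closure properties of this predicate
    can be found by type inference. *)
Definition subspace_pred of csubspace K : {pred H} := fun x => `[< K x >].

Lemma subspace_predP : submod_closed (subspace_pred csK).
Proof.
have [K0 KD KZ] := csK; split=> [|c x y]; rewrite !unfold_in; first exact/asboolP.
by move=> /asboolP Kx /asboolP Ky; apply/asboolP/KD => //; exact: KZ.
Qed.

HB.instance Definition _ :=
  GRing.isSubmodClosed.Build R[i] H (subspace_pred csK) subspace_predP.

Record subspace_type := SubspaceElt {
  subspace_val :> H;
  subspace_valP : subspace_val \in subspace_pred csK }.

HB.instance Definition _ := [isSub for subspace_val].
HB.instance Definition _ := [Choice of subspace_type by <:].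
HB.instance Definition _ := [SubChoice_isSubZmodule of subspace_type by <:].
HB.instance Definition _ := [SubZmodule_isSubLmodule of subspace_type by <:].

Definition subspace_ip (u v : subspace_type) : R[i] :=
  hdot (subspace_val u) (subspace_val v).

Lemma subspace_ip_inner : inner_product subspace_ip.
Proof.
split=> [c x y z|x y|x x0]; rewrite /subspace_ip.
- exact: linearPl.
- exact: hdotC.
- by apply: neq0_dnorm_gt0; apply: contra x0 => /eqP h; apply/eqP/val_inj.
Qed.

Lemma subspace_ip_norm u : ip_norm subspace_ip u = hnorm (subspace_val u).
Proof. by rewrite hnorm_ip. Qed.

Lemma subspace_ip_complete : ip_complete subspace_ip.
Proof.
move=> F FF Fc.
have [|l hl] := @hilbert_filter_complete R H (subspace_val @ F) _.
  move=> e /Fc[x Fx]; exists (subspace_val x).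
  change (F [set u | hnorm (subspace_val x - subspace_val u) < e]).
  by apply: filterS Fx => y; rewrite /= subspace_ip_norm.
have Kl : K l.
  apply: clK => e e0.
  have h : F [set u | hnorm (l - subspace_val u) < e] := hl _ e0.
  have [u hu] := filter_ex h; exists (subspace_val u) => //.
  exact/asboolP/(subspace_valP u).
exists (SubspaceElt (introT (asboolP _) Kl : l \in subspace_pred csK)) => e e0.
have h : F [set u | hnorm (l - subspace_val u) < e] := hl _ e0.
by apply: filterS h => u; rewrite /= subspace_ip_norm.
Qed.

Definition hsubspace : hilbertSpace R :=
  hilbert_of_ip subspace_ip_inner subspace_ip_complete.

Definition hval (u : hsubspace) : H := subspace_val u.

Lemma hval_in u : K (hval u).
Proof. exact/asboolP/(subspace_valP u). Qed.

Lemma hval_inj : injective hval.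
Proof. exact: val_inj. Qed.

Lemma hvalD u v : hval (u + v) = hval u + hval v. Proof. by []. Qed.
Lemma hvalB u v : hval (u - v) = hval u - hval v. Proof. by []. Qed.
Lemma hvalZ c u : hval (c *: u) = c *: hval u. Proof. by []. Qed.

Lemma hval_dot u v : hdot (hval u) (hval v) = hdot u v. Proof. by []. Qed.

Lemma hval_norm u : hnorm (hval u) = hnorm u.
Proof.
by apply/eqP; rewrite -(@eqrXn2 _ 2) ?hnorm_ge0 // !hnorm_sqr /rdot hval_dot.
Qed.

Lemma hval_surj x : K x -> exists u, hval u = x.
Proof.
by move=> Kx; exists (SubspaceElt (introT (asboolP _) Kx : x \in subspace_pred csK)).
Qed.

(** The orthogonal projection of [H] onto [K], with values in [K] as a space. *)
Definition hrestr (x : H) : hsubspace := get [set u | hval u = hproj K x].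

Lemma hval_restr x : hval (hrestr x) = hproj K x.
Proof.
apply: (@getPex _ [set u | hval u = hproj K x]).
by apply: hval_surj; exact: hproj_in.
Qed.

Lemma hrestr_val u : hrestr (hval u) = u.
Proof. by apply: hval_inj; rewrite hval_restr hproj_id //; exact: hval_in. Qed.

End ClosedSubspace.

(** * Three projections that encode an operator *)

Section Commutation.
Context {R : realType} {H : hilbertSpace R}.
Implicit Types (S T W f : H -> H).

Lemma adjoint_commute S S' f f' : adjoint S S' -> adjoint f f' ->
  S \o f = f \o S -> S' \o f' = f' \o S'.
Proof.
move=> SS ff h; apply/funext => x; apply: hdot_extr => y /=.
rewrite -SS -ff -ff -SS.
by have /(congr1 (@^~ y)) /= -> := h.
Qed.

Lemma commute_invariant (K : set H) W : csubspace K -> hclosed K -> 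
  W \o hproj K = hproj K \o W -> forall u, K u -> K (W u).
Proof.
move=> cK lK h u Ku; have /(congr1 (@^~ u)) /= := h.
by rewrite (hproj_id cK lK Ku) => ->; exact: hproj_in.
Qed.

End Commutation.

Section GraphProjections.
Context {R : realType} {H : hilbertSpace R}.
Local Notation HH := (hsquare H).
Implicit Types (f S T : H -> H) (W : HH -> HH) (x y : H) (u v : HH).

Definition dsum S u : HH := hpair (S (hfst u)) (S (hsnd u)).

Lemma hpair_norm_le x y M (a b : H) : 0 <= M ->
  hnorm x <= M * hnorm a -> hnorm y <= M * hnorm b ->
  hnorm (hpair x y) <= M * hnorm (hpair a b).
Proof.
move=> M0 xa yb; rewrite -(@ler_pXn2r _ 2) ?nnegrE ?mulr_ge0 ?hnorm_ge0 //.
rewrite exprMn !hnorm_square !hfst_pair !hsnd_pair mulrDr -!exprMn.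
by rewrite lerD // ler_pXn2r ?nnegrE ?mulr_ge0 ?hnorm_ge0.
Qed.

Lemma hfst_norm u : hnorm (hfst u) <= hnorm u.
Proof.
rewrite -(@ler_pXn2r _ 2) ?nnegrE ?hnorm_ge0 //.
by rewrite [leRHS]hnorm_square lerDl sqr_ge0.
Qed.

Lemma hsnd_norm u : hnorm (hsnd u) <= hnorm u.
Proof.
rewrite -(@ler_pXn2r _ 2) ?nnegrE ?hnorm_ge0 //.
by rewrite [leRHS]hnorm_square lerDr sqr_ge0.
Qed.

Lemma hnorm_inl x : hnorm (hpair x 0) = hnorm x.
Proof.
apply/eqP; rewrite -(@eqrXn2 _ 2) ?hnorm_ge0 // hnorm_square.
by rewrite hfst_pair hsnd_pair hnorm0 expr0n addr0.
Qed.

Lemma hnorm_inr x : hnorm (hpair 0 x) = hnorm x.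
Proof.
apply/eqP; rewrite -(@eqrXn2 _ 2) ?hnorm_ge0 // hnorm_square.
by rewrite hfst_pair hsnd_pair hnorm0 expr0n add0r.
Qed.

Lemma dsum_bounded S : bounded_op S -> bounded_op (dsum S).
Proof.
move=> bS; have [M M0 hM] := bop_bound bS.
apply: (@bounded_opI _ _ _ M) => [u v|c u|u].
- by rewrite /dsum hfstD hsndD !(bopD _ _ bS) hpairD.
- by rewrite /dsum hfstZ hsndZ !(bopZ _ _ bS) hpairZ.
- by rewrite -{2}(hpair_eta u); apply: hpair_norm_le.
Qed.

Lemma dsum_adjoint S S' : adjoint S S' -> adjoint (dsum S) (dsum S').
Proof. by move=> h u v; rewrite !hdot_square /dsum !hfst_pair !hsnd_pair !h. Qed.

Definition graph f : set HH := [set u | hsnd u = f (hfst u)].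

Lemma graphE f u : graph f u = (hsnd u = f (hfst u)).
Proof. by []. Qed.

Lemma graph_csubspace f : bounded_op f -> csubspace (graph f).
Proof.
move=> bf; split=> [|u v|c u]; rewrite !graphE.
- by rewrite (bop0 bf).
- by rewrite hfstD hsndD (bopD _ _ bf) => -> ->.
- by rewrite hfstZ hsndZ (bopZ _ _ bf) => ->.
Qed.

Lemma graph_closed f : bounded_op f -> hclosed (graph f).
Proof.
move=> bf u hu; have [M M0 hM] := bop_bound bf.
apply: hnorm_ext => e e0; have M1 : 0 < M + 1 by rewrite ltr_wpDl.
have [v gv uv] := hu _ (divr_gt0 e0 M1).
have -> : hsnd u - f (hfst u) = hsnd (u - v) - f (hfst (u - v)).
  by rewrite hsndB hfstB (bopB _ _ bf) gv opprB addrA subrK.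
apply: le_lt_trans (hnorm_leB _ _) _.
have h1 := hsnd_norm (u - v); have h2 := hM (hfst (u - v)).
have h3 : M * hnorm (hfst (u - v)) <= M * hnorm (u - v).
  by rewrite ler_wpM2l // hfst_norm.
move: uv; rewrite ltr_pdivlMr //; lra.
Qed.

Lemma dsum_commute_graph f S S' : bounded_op f -> bounded_op S ->
  adjoint S S' -> S \o f = f \o S -> S' \o f = f \o S' ->
  dsum S \o hproj (graph f) = hproj (graph f) \o dsum S.
Proof.
move=> bf bS SS' Sf S'f; apply: (@hproj_commute _ _ _ (graph_csubspace bf) (graph_closed bf) _ (dsum S')).
- exact: dsum_bounded.
- exact: dsum_adjoint.
- by move=> u gu; rewrite graphE /dsum hfst_pair hsnd_pair gu;
    have /(congr1 (@^~ (hfst u))) := Sf.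
- by move=> u gu; rewrite graphE /dsum hfst_pair hsnd_pair gu;
    have /(congr1 (@^~ (hfst u))) := S'f.
Qed.

Lemma hproj_graph0 u : hproj (graph (fun=> 0)) u = hpair (hfst u) 0.
Proof.
apply: hprojE => //.
- exact/graph_csubspace/bop_zero.
- exact/graph_closed/bop_zero.
- move=> v gv; rewrite hdot_square hfstB hsndB hfst_pair hsnd_pair subrr.
  by rewrite hdot0l gv hdot0r addr0.
Qed.

(** The graphs of [0], [id] and [T]: the first axis, the diagonal and the graph of
    [T]. *)
Definition graph_proj T (i : 'I_3) : HH -> HH :=
  hproj (graph (nth id [:: fun=> 0; id; T] i)).

Lemma graph_proj_projection T i : bounded_op T -> projection (graph_proj T i).
Proof.
move=> bT; have bf : bounded_op (nth id [:: fun=> 0; id; T] i).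
  case: i => -[|[|[|//]]] _ /=; [exact: bop_zero|exact: bop_id|exact: bT].
by apply: hproj_projection; [exact: graph_csubspace|exact: graph_closed].
Qed.

(** [T] and its adjoint generate the same von Neumann algebra as [T], namely their
    bicommutant, and a set has the same commutant as its bicommutant. *)
Lemma commutant_vN_generated1 T T' : bounded_op T -> bounded_op T' ->
  adjoint T T' -> commutant (vN_generated [set T]) = commutant [set T; T'].
Proof.
move=> bT bT' TT'; have Fb : [set T; T'] `<=` bounded_op by move=> S [] ->.
have vM : von_neumann_algebra (vN_generated [set T]).
  by apply: vN_generated_vN => S ->.
apply/seteqP; split.
  apply: commutantS => S [->|->]; first exact: sub_vN_generated.
  apply: (vN_selfadjoint vM) _ bT' TT'; exact: sub_vN_generated.
rewrite -(commutant3 Fb); apply: commutantS => S; apply.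
  apply/vN_commutant/commutant_vN => // S1 S2 [->|->] bS2 h; [right|left].
    exact: adjoint_uniq h TT'.
  exact: adjoint_uniq h (adjointC TT').
by move=> _ ->; apply: sub_bicommutant => //; left.
Qed.

(** Commuting with the projection onto the first axis makes [W] diagonal, keeping the
    diagonal invariant makes the two entries equal to one operator [S], and keeping
    the graph of [T] invariant says [S T = T S]. The adjoint of [W] has the same
    properties, so [S] also commutes with the adjoint of [T]. *)
Lemma commutant_graph_proj T : bounded_op T ->
  commutant (range (graph_proj T))
  = [set dsum S | S in commutant (vN_generated [set T])].
Proof.
move=> bT; have [T' bT' TT'] := adjoint_exists bT.
rewrite (commutant_vN_generated1 bT bT' TT'); apply/seteqP; split; last first.
  move=> _ [S [bS cS] <-]; split; first exact: dsum_bounded.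
  have [S' bS' SS'] := adjoint_exists bS.
  move=> _ [i _ <-]; apply: (dsum_commute_graph (S' := S')) => //.
  - by case: i => -[|[|[|//]]] _ /=; [exact: bop_zero|exact: bop_id|].
  - case: i => -[|[|[|//]]] _ //=; last by apply: cS; left.
    by apply/funext => x /=; rewrite (bop0 bS).
  - case: i => -[|[|[|//]]] _ //=.
      by apply/funext => x /=; rewrite (bop0 bS').
    apply: (adjoint_commute SS' (adjointC TT')).
    by apply: cS; right.
move=> W [bW cW].
have diagW V : bounded_op V -> (forall i, V \o graph_proj T i = graph_proj T i \o V) ->
    V = dsum (fun x => hfst (V (hpair x 0))) /\
    (fun x => hfst (V (hpair x 0))) \o T = T \o (fun x => hfst (V (hpair x 0))).
  move=> bV cV; set S := fun x => _.
  have c0 := cV (@Ordinal 3 0 isT); have c1 := cV (@Ordinal 3 1 isT).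
  have c2 := cV (@Ordinal 3 2 isT).
  have i0 := commute_invariant (graph_csubspace (@bop_zero R H))
    (graph_closed (@bop_zero R H)) c0.
  have i1 := commute_invariant (graph_csubspace (@bop_id R H))
    (graph_closed (@bop_id R H)) c1.
  have i2 := commute_invariant (graph_csubspace bT) (graph_closed bT) c2.
  have V1 x : V (hpair x 0) = hpair (S x) 0.
    by rewrite -(hpair_eta (V (hpair x 0))) (i0 (hpair x 0)).
  have V2 x : hfst (V (hpair 0 x)) = 0.
    have : V (hproj (graph (fun=> 0)) (hpair 0 x))
         = hproj (graph (fun=> 0)) (V (hpair 0 x)).
      exact: (congr1 (@^~ (hpair 0 x)) c0).
    rewrite !hproj_graph0 hfst_pair; have -> : hpair 0 0 = 0 :> HH by [].
    by rewrite (bop0 bV) => /(congr1 (@hfst R H)); rewrite hfst_pair => <-.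
  have VD x y : V (hpair x y) = V (hpair x 0) + V (hpair 0 y).
    by rewrite -(bopD _ _ bV) hpairD addr0 add0r.
  have V3 x : V (hpair 0 x) = hpair 0 (S x).
    rewrite -(hpair_eta (V (hpair 0 x))) V2; congr hpair.
    have := i1 (hpair x x) (erefl _); rewrite graphE VD hsndD hfstD V1 V2.
    by rewrite hsnd_pair hfst_pair add0r addr0.
  have VE x y : V (hpair x y) = hpair (S x) (S y).
    by rewrite VD V1 V3 hpairD addr0 add0r.
  split; first by apply/funext => u; rewrite -{1}(hpair_eta u) VE.
  apply/funext => x; have := i2 (hpair x (T x)) (erefl _).
  by rewrite /graph /= VE.
have [W' bW' WW'] := adjoint_exists bW.
have cW1 i : W \o graph_proj T i = graph_proj T i \o W by apply: cW; exists i.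
have cW2 i : W' \o graph_proj T i = graph_proj T i \o W'.
  apply: (adjoint_commute WW' _ (cW1 i)).
  by case: (graph_proj_projection i bT).
have [WE WT] := diagW _ bW cW1; have [WE' WT'] := diagW _ bW' cW2.
set S := fun x => hfst (W (hpair x 0)) in WE WT *.
set S' := fun x => hfst (W' (hpair x 0)) in WE' WT' *.
have SS' : adjoint S S'.
  move=> x y; have := WW' (hpair x 0) (hpair y 0).
  by rewrite !hdot_square !hfst_pair !hsnd_pair hdot0r hdot0l !addr0.
have [M M0 hM] := bop_bound bW.
have bS : bounded_op S.
  apply: (@bounded_opI _ _ _ M) => [x y|c x|x].
  - by rewrite /S -hfstD -(bopD _ _ bW) hpairD addr0.
  - by rewrite /S -hfstZ -(bopZ _ _ bW) hpairZ scaler0.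
  - by apply: le_trans (hfst_norm _) _; rewrite -(hnorm_inl x).
exists S => //; split=> // f [->|->] //.
exact: (adjoint_commute (adjointC SS') TT').
Qed.

End GraphProjections.

(** * Adjoining projections to the scalars *)

Section Scalars.
Context {R : realType} {H : hilbertSpace R}.
Implicit Types (S T : H -> H) (X : set (H -> H)) (x y z : H).

Lemma hdot_norm_sqr x : hdot x x = (hnorm x ^+ 2)%:C.
Proof. by rewrite -hdot_norm normr_hnorm rmorphXn. Qed.

Lemma rank_one_bounded x y : bounded_op (fun z => hdot z y *: x).
Proof.
apply: (@bounded_opI _ _ _ (hnorm y * hnorm x)) => [u v|c u|u].
- by rewrite hdotDl scalerDl.
- by rewrite hdotZl scalerA.
- by rewrite hnormZ mulrAC ler_wpM2r ?hnorm_ge0 // mulrC hdot_CS.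
Qed.

(** An operator commuting with the rank-one operator of [x] has [x] as an
    eigenvector. *)
Lemma ann_scalars x y : hdot x y = 0 -> ann (commutant (@bounded_op R H)) x y.
Proof.
move=> xy S [bS cS]; have [->|x0] := eqVneq x 0; first by rewrite (bop0 bS) hdot0l.
have /(congr1 (@^~ x)) /= := cS _ (rank_one_bounded x x).
rewrite (bopZ _ _ bS) => /(congr1 (fun w => hdot w y)) /=.
rewrite !hdotZl xy mulr0 => /eqP; rewrite mulf_eq0 => /orP[|/eqP //].
by rewrite hdot_norm_sqr => /eqP[/eqP]; rewrite sqrf_eq0 gt_eqF ?hnorm_gt0.
Qed.

Lemma re_normD (a b : R[i]) : complex.Re `|a + b| <= complex.Re `|a| + complex.Re `|b|.
Proof. by have := ler_normD a b; rewrite lecE => /andP[_]. Qed.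

(** [T] is compared with the scalar [<T x0, x0>] for a unit vector [x0]. The bound
    controls [T x - <T x, x> x] by [c]; it also controls the differences of diagonal
    entries by [4 c], through the orthogonal vectors [x + y] and [x - y]. Splitting a
    vector along [x0] then costs [c + (c + 4 c)]. *)
Lemma scalars_distance_estimate X : X `<=` bounded_op ->
  (forall c, X (fun x => c *: x)) ->
  (forall x y, hdot x y = 0 -> ann X x y) -> distance_estimate X 6.
Proof.
move=> Xb XZ Xa T c bT c0 hc d cd.
have [[x1 x10]|h0] := pselect (exists x : H, x != 0); last first.
  exists (fun x => 0 *: x) => // x.
  have -> : x = 0 by apply: contrapT => /eqP x0; apply: h0; exists x.
  by rewrite (bop0 bT) scaler0 subr0 !hnorm0 mulr0.
have offdiag x y : hdot x y = 0 -> complex.Re `|hdot (T x) y| <= c * hnorm x * hnorm y.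
  by move=> /Xa; exact: rank_one_bound_norm.
pose l x := hdot (T x) x.
have step1 x : hnorm x = 1 -> hnorm (T x - l x *: x) <= c.
  move=> x1'; set w := T x - l x *: x.
  have wx : hdot x w = 0.
    by rewrite hdotC /w hdotBl hdotZl hdot_norm_sqr x1' expr1n mulr1 subrr conjc0.
  have [->|/hnorm_gt0 w0] := eqVneq w 0; first by rewrite hnorm0.
  rewrite -(ler_pM2r w0) -expr2 hnorm_sqr {1}/w /rdot hdotBl hdotZl wx mulr0 subr0.
  by apply: le_trans (rdot_le_hdot _ _) _; have := offdiag _ _ wx; rewrite x1' mulr1.
have step2 x y : hnorm x = 1 -> hnorm y = 1 -> hdot x y = 0 ->
    complex.Re `|l y - l x| <= 4 * c.
  move=> nx ny xy.
  have yx : hdot y x = 0 by rewrite hdotC xy conjc0.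
  have nn : hnorm (x + y) * hnorm (x - y) = 2.
    have e1 : hnorm (x + y) ^+ 2 = 2.
      rewrite hnorm_sqr !rdotE -!hnorm_sqr nx ny /rdot xy yx /=; ring.
    have e2 : hnorm (x - y) ^+ 2 = 2.
      rewrite hnorm_sqr !rdotE -!hnorm_sqr nx ny /rdot xy yx /=; ring.
    apply/eqP; rewrite -(@eqrXn2 _ 2) ?mulr_ge0 ?hnorm_ge0 //.
    by rewrite exprMn e1 e2 -expr2.
  have h1 : complex.Re `|hdot (T (x + y)) (x - y)| <= 2 * c.
    have := @offdiag (x + y) (x - y); rewrite -mulrA nn mulrC; apply.
    by rewrite hdotDl !hdotBr xy yx !hdot_norm_sqr nx ny subr0 sub0r subrr.
  have h2 := offdiag _ _ xy; have h3 := offdiag _ _ yx.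
  rewrite nx ny !mulr1 in h2 h3.
  have -> : l y - l x
      = - hdot (T (x + y)) (x - y) + (- hdot (T x) y + hdot (T y) x).
    by rewrite (bopD _ _ bT) hdotDl !hdotBr /l; ring.
  apply: le_trans (re_normD _ _) _.
  have := re_normD (- hdot (T x) y) (hdot (T y) x).
  rewrite !normrN; lra.
pose x0 := (hnorm x1)^-1%:C *: x1.
have n0 : hnorm x0 = 1.
  have p := hnorm_gt0 x10.
  by rewrite hnormZr ger0_norm ?invr_ge0 ?(ltW p) // mulVf ?gt_eqF.
exists (fun z => l x0 *: z) => // z.
pose a := hdot z x0.
have [y yx zE] : exists2 y, hdot x0 y = 0 & z = a *: x0 + y.
  exists (z - a *: x0); last by rewrite addrC subrK.
  by rewrite hdotC hdotBl hdotZl hdot_norm_sqr n0 expr1n mulr1 subrr conjc0.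
have az : complex.Re `|a| <= hnorm z by have := hdot_CS z x0; rewrite n0 mulr1.
have yz : hnorm y <= hnorm z.
  have e : rdot (a *: x0) y = 0 by rewrite /rdot hdotZl yx mulr0.
  rewrite -(@ler_pXn2r _ 2) ?nnegrE ?hnorm_ge0 //.
  rewrite [leRHS]hnorm_sqr zE rdotDl !rdotDr (rdotC y (a *: x0)) e addr0 add0r.
  by rewrite -!hnorm_sqr lerDr sqr_ge0.
have h1 : hnorm (T (a *: x0) - l x0 *: (a *: x0)) <= c * hnorm z.
  rewrite (bopZ _ _ bT) scalerA mulrC -scalerA -scalerBr hnormZ mulrC.
  by rewrite ler_pM ?hnorm_ge0 ?step1 // ; have := normr_ge0 a; rewrite lecE => /andP[].
have h2 : hnorm (T y - l x0 *: y) <= 5 * c * hnorm z.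
  apply: (@le_trans _ _ (5 * c * hnorm y)); last by rewrite ler_wpM2l ?mulr_ge0.
  have [->|/hnorm_gt0 y0] := eqVneq y 0.
    by rewrite (bop0 bT) scaler0 subr0 hnorm0 mulr0.
  pose y' := (hnorm y)^-1%:C *: y.
  have ny' : hnorm y' = 1.
    by rewrite hnormZr ger0_norm ?invr_ge0 ?(ltW y0) // mulVf ?gt_eqF.
  have yE : y = (hnorm y)%:C *: y'.
    by rewrite /y' scalerA -rmorphM divff ?gt_eqF // scale1r.
  have y'x : hdot x0 y' = 0 by rewrite /y' hdotZr yx mulr0.
  rewrite [in leLHS]yE (bopZ _ _ bT) scalerA mulrC -scalerA -scalerBr hnormZr.
  rewrite ger0_norm ?(ltW y0) // mulrC ler_wpM2r ?(ltW y0) //.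
  have -> : T y' - l x0 *: y' = (T y' - l y' *: y') + (l y' - l x0) *: y'.
    by rewrite scalerBl addrA subrK.
  apply: le_trans (hnorm_leD _ _) _; rewrite hnormZ ny' mulr1.
  have := step1 _ ny'; have := step2 _ _ n0 ny' y'x; lra.
rewrite {1 2}zE (bopD _ _ bT) scalerDr opprD addrACA.
apply: le_trans (hnorm_leD _ _) _.
have := ler_wpM2r (hnorm_ge0 z) (ltW cd); lra.
Qed.

Lemma commutant_set0 : commutant set0 = @bounded_op R H.
Proof. by apply/seteqP; split=> [T []|T bT]. Qed.

Lemma hyperreflexive_scalars : hyperreflexive (commutant (@bounded_op R H)).
Proof.
apply: distance_estimate_hyperreflexive; first exact/vN_commutant/bounded_op_vN.
exists 6 => //; apply: scalars_distance_estimate.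
- exact: commutant_bounded.
- move=> c; split; first exact: (bop_scale c (@bop_id R H)).
  by move=> S bS; apply/funext => x /=; rewrite (bopZ _ _ bS).
- exact: ann_scalars.
Qed.

Lemma bicommutant_vN F : F `<=` bounded_op -> selfadjoint_set F ->
  von_neumann_algebra (commutant (commutant F) : set (H -> H)).
Proof. by move=> Fb Fs; apply/vN_commutant/commutant_vN. Qed.

Lemma bicommutant_min F (B : set (H -> H)) : von_neumann_algebra B ->
  F `<=` B -> commutant (commutant F) `<=` B.
Proof.
by move=> vB FB; rewrite -(vN_bicommutant vB); apply: commutantS; exact: commutantS.
Qed.

(** Both sides are the least von Neumann algebra containing [F] and [G]. *)
Lemma vN_join_bicommutant (F G : set (H -> H)) :
  F `<=` bounded_op -> selfadjoint_set F ->
  G `<=` bounded_op -> selfadjoint_set G ->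
  vN_join (commutant (commutant F)) (commutant (commutant G))
  = commutant (commutant (F `|` G)).
Proof.
move=> Fb Fs Gb Gs.
have FGb : F `|` G `<=` bounded_op by move=> T [/Fb|/Gb].
have FGs : selfadjoint_set (F `|` G).
  by move=> T S [/Fs h|/Gs h] bS TS; [left|right]; exact: h TS.
apply/seteqP; split.
  move=> T; apply; first exact: bicommutant_vN.
  by move=> S []; move: S; do 2!apply: commutantS; move=> S FS; [left|right].
apply: bicommutant_min.
  by apply: vN_generated_vN => T [] [].
move=> T [FT|GT]; apply: sub_vN_generated; [left|right];
  exact: sub_bicommutant.
Qed.

Lemma hyperreflexive_finitely_many_projections :
  (forall (A : set (H -> H)) (Q : H -> H),
     von_neumann_algebra A -> hyperreflexive A -> projection Q ->
     hyperreflexive (vN_join A (commutant (commutant [set Q])))) ->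
  forall (Q : nat -> H -> H) n, (forall i, projection (Q i)) ->
  hyperreflexive (commutant (commutant [set Q i | i in `I_n])).
Proof.
move=> join_hyp Q n Qp.
have Fp m : [set Q i | i in `I_m] `<=` projection by move=> _ [i _ <-].
have pb (F : set (H -> H)) : F `<=` projection -> F `<=` bounded_op.
  by move=> Fproj T /Fproj/projection_bounded.
elim: n => [|n IHn].
  by rewrite II0 image_set0 commutant_set0; exact: hyperreflexive_scalars.
have sp : [set Q n] `<=` projection by move=> _ ->.
have -> : [set Q i | i in `I_n.+1] = [set Q i | i in `I_n] `|` [set Q n].
  apply/seteqP; split=> [_ [i /= ni <-]|_ [[i /= ni <-]|->]].
  - by move: ni; rewrite ltnS leq_eqVlt => /predU1P[->|?]; [right|left; exists i].
  - by exists i => //=; exact: ltnW.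
  - by exists n => //=.
rewrite -vN_join_bicommutant; [|exact: pb|exact: projections_selfadjoint
  |exact: pb|exact: projections_selfadjoint].
apply: join_hyp => //.
by apply: bicommutant_vN; [exact: pb|exact: projections_selfadjoint].
Qed.

End Scalars.

Section Compression.
Context {R : realType} {H : hilbertSpace R}.
Local Notation HH := (hsquare H).
Implicit Types (S T : H -> H) (x y z : H).

Lemma cauchy_schwarz2 (a b c d p q : R) : 0 <= p -> 0 <= q ->
  p ^+ 2 = a ^+ 2 + b ^+ 2 -> q ^+ 2 = c ^+ 2 + d ^+ 2 -> a * c + b * d <= p * q.
Proof.
move=> p0 q0 hp hq; apply: le_trans (ler_norm _) _.
rewrite -(@ler_pXn2r _ 2) ?nnegrE ?mulr_ge0 // exprMn hp hq real_normK ?num_real //.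
have := sqr_ge0 (a * d - b * c); nra.
Qed.

(** The commutant of the operators [S (+) S], [S] in [A'], consists of the 2 by 2
    matrices over [A]. A pair of vectors annihilating this matrix algebra annihilates
    [A] in each coordinate, so [T (+) T] inherits the bound of [T]; the upper left entry
    of an operator approximating [T (+) T] approximates [T]. *)
Lemma distance_estimate_corner (A : set (H -> H)) k : von_neumann_algebra A ->
  distance_estimate (commutant [set dsum S | S in commutant A] : set (HH -> HH)) k ->
  distance_estimate A k.
Proof.
move=> vA hk T c bT c0 hc d cd.
have corner S : A S -> commutant [set dsum S | S in commutant A]
    (fun u : HH => hpair (S (hfst u)) 0) /\
    commutant [set dsum S | S in commutant A] (fun u : HH => hpair 0 (S (hsnd u))).
  move=> AS; have bS := vN_bounded vA AS; have [M M0 hM] := bop_bound bS.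
  split; split.
  - apply: (@bounded_opI _ _ _ M) => [u v|a u|u].
    + by rewrite hfstD (bopD _ _ bS) hpairD addr0.
    + by rewrite hfstZ (bopZ _ _ bS) hpairZ scaler0.
    + by rewrite hnorm_inl; apply: le_trans (hM _) _; rewrite ler_wpM2l // hfst_norm.
  - move=> _ [S' [bS' cS'] <-]; apply/funext => u /=; rewrite /dsum hfst_pair hsnd_pair.
    by rewrite (bop0 bS') -[S' (S _)]/((S' \o S) _) (cS' _ AS).
  - apply: (@bounded_opI _ _ _ M) => [u v|a u|u].
    + by rewrite hsndD (bopD _ _ bS) hpairD addr0.
    + by rewrite hsndZ (bopZ _ _ bS) hpairZ scaler0.
    + by rewrite hnorm_inr; apply: le_trans (hM _) _; rewrite ler_wpM2l // hsnd_norm.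
  - move=> _ [S' [bS' cS'] <-]; apply/funext => u /=; rewrite /dsum hfst_pair hsnd_pair.
    by rewrite (bop0 bS') -[S' (S _)]/((S' \o S) _) (cS' _ AS).
have [|W [bW cW] hW] := hk (dsum T) c (dsum_bounded bT) c0 _ d cd.
  move=> u v a; rewrite rdot_square /dsum hfst_pair hsnd_pair.
  have a1 : ann A (hfst u) (hfst v).
    move=> S /corner[/a + _]; rewrite hdot_square hfst_pair hsnd_pair hdot0l addr0.
    by [].
  have a2 : ann A (hsnd u) (hsnd v).
    move=> S /corner[_ /a]; rewrite hdot_square hfst_pair hsnd_pair hdot0l add0r.
    by [].
  apply: le_trans (lerD (hc _ _ a1) (hc _ _ a2)) _.
  rewrite -!mulrA -mulrDr ler_wpM2l //.
  by apply: cauchy_schwarz2; rewrite ?hnorm_ge0 // hnorm_square.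
exists (fun x => hfst (W (hpair x 0))).
  rewrite -(vN_bicommutant vA); split.
    have [M M0 hM] := bop_bound bW.
    apply: (@bounded_opI _ _ _ M) => [x y|a x|x].
    - by rewrite -hfstD -(bopD _ _ bW) hpairD addr0.
    - by rewrite -hfstZ -(bopZ _ _ bW) hpairZ scaler0.
    - by apply: le_trans (hfst_norm _) _; rewrite -(hnorm_inl x).
  move=> S cS; have [bS _] := cS; apply/funext => x /=.
  have : [set dsum S | S in commutant A] (dsum S) by exists S.
  move=> /cW /(congr1 (@^~ (hpair x 0))) /=.
  by rewrite {1}/dsum hfst_pair hsnd_pair (bop0 bS) => ->.
move=> x; rewrite -(hnorm_inl x); apply: le_trans (hW _).
exact: (hfst_norm (dsum T (hpair x 0) - W (hpair x 0))).
Qed.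

End Compression.

(** With [A] generated by [T], the bicommutant of the three projections attached to
    [T] is the algebra of 2 by 2 matrices over [A], and it is reached from the scalars
    by adjoining the projections one at a time. *)
Lemma hyperreflexive_of_joins (R : realType) (H : hilbertSpace R)
    (A : set (H -> H)) :
  (forall (A : set (hsquare H -> hsquare H)) Q,
     von_neumann_algebra A -> hyperreflexive A -> projection Q ->
     hyperreflexive (vN_join A (commutant (commutant [set Q])))) ->
  von_neumann_algebra A -> singly_generated A -> hyperreflexive A.
Proof.
move=> join_hyp vA [T bT AE].
have Qp (i : nat) : projection (graph_proj T (inord i)) by exact: graph_proj_projection.
have := hyperreflexive_finitely_many_projections join_hyp 3 Qp.
have -> : [set graph_proj T (inord i) | i in `I_3] = range (graph_proj T).
  apply/seteqP; split=> [_ [i _ <-]|_ [i _ <-]]; first by exists (inord i).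
  by exists i; rewrite /= ?ltn_ord ?inord_val.
rewrite commutant_graph_proj // -AE => /hyperreflexive_distance_estimate[k k0 hk].
apply: distance_estimate_hyperreflexive => //.
by exists k => //; exact: distance_estimate_corner.
Qed.

(** * Absolute values of self-adjoint operators *)

Section AbsoluteValue.
Context {R : realType} {H : hilbertSpace R}.
Implicit Types (S T b : H -> H) (x y z : H) (u v : nat -> H).

Lemma hlim_uniq u l l' : hlim u l -> hlim u l' -> l = l'.
Proof.
move=> ul ul'; apply: hnorm_ext => e e0; have e2 : 0 < e / 2 by rewrite divr_gt0.
have [[N hN] [N' hN']] := (ul _ e2, ul' _ e2); pose n := maxn N N'.
have -> : l - l' = (u n - l') - (u n - l) by rewrite opprB [RHS]addrC addrA subrK.
apply: le_lt_trans (hnorm_leB _ _) _.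
have := hN n (leq_maxl _ _); have := hN' n (leq_maxr _ _); lra.
Qed.

Lemma hlim_cst (l : H) : hlim (fun=> l) l.
Proof. by move=> e e0; exists 0%N => n _; rewrite subrr hnorm0. Qed.

Lemma hlimD u v l k : hlim u l -> hlim v k -> hlim (fun n => u n + v n) (l + k).
Proof.
move=> ul vk e e0; have e2 : 0 < e / 2 by rewrite divr_gt0.
have [[N hN] [N' hN']] := (ul _ e2, vk _ e2); exists (maxn N N') => n.
rewrite geq_max => /andP[Nn N'n]; rewrite opprD addrACA.
apply: le_lt_trans (hnorm_leD _ _) _; have := hN _ Nn; have := hN' _ N'n; lra.
Qed.

Lemma hlim_bop T u l : bounded_op T -> hlim u l -> hlim (T \o u) (T l).
Proof.
move=> bT ul e e0; have [M M0 hM] := bop_bound bT.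
have M1 : 0 < M + 1 by rewrite ltr_wpDl.
have [N hN] := ul _ (divr_gt0 e0 M1); exists N => n /hN; rewrite ltr_pdivlMr // => h.
rewrite /= -(bopB _ _ bT); apply: le_lt_trans (hM _) _.
have := hnorm_ge0 (u n - l); lra.
Qed.

Lemma hlim_norm_le u l C : hlim u l -> (forall n, hnorm (u n) <= C) -> hnorm l <= C.
Proof.
move=> ul uC; apply/ler_addgt0Pl => e /ul[N hN].
have -> : l = u N - (u N - l) by rewrite opprB addrC subrK.
by apply: le_trans (hnorm_leB _ _) _; have := hN N (leqnn _); have := uC N; lra.
Qed.

Lemma hlim_rdot u l y r : hlim u l -> (forall n, rdot (u n) y = r n) ->
  forall e, 0 < e -> exists N, forall n, (N <= n)%N -> `|r n - rdot l y| < e.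
Proof.
move=> ul ur e e0; have y1 : 0 < hnorm y + 1 by rewrite ltr_wpDl ?hnorm_ge0.
have [N hN] := ul _ (divr_gt0 e0 y1); exists N => n /hN; rewrite ltr_pdivlMr // => h.
rewrite -ur -rdotBl; apply: le_lt_trans (norm_rdot_CS _ _) _.
have := hnorm_ge0 (u n - l); lra.
Qed.

(** The square root of [b^2] is [1 - s], where [s] is the limit of the iteration
    [s <- (1 - b^2 + s^2) / 2]. *)
Fixpoint sqrt_iter b n x : H :=
  if n is m.+1 then
    (2^-1 : R)%:C *: ((x - b (b x)) + sqrt_iter b m (sqrt_iter b m x))
  else 0.

(** The same iteration for scalars with [1 - b^2] replaced by its norm bound 1. It
    increases and stays below 1, and its increments dominate those of the operator
    iteration, which therefore converges. *)
Fixpoint sqrt_major n : R :=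
  if n is m.+1 then 2^-1 * (1 + sqrt_major m ^+ 2) else 0.

Lemma sqrt_major_bound n : 0 <= sqrt_major n <= 1.
Proof.
elim: n => [|n /andP[h0 h1]] /=; first by rewrite lexx ler01.
have := exprn_ile1 2 h0 h1; have := sqr_ge0 (sqrt_major n).
by move=> ? ?; apply/andP; split; lra.
Qed.

Lemma sqrt_major_le n : sqrt_major n <= sqrt_major n.+1.
Proof.
elim: n => [|n]; first by rewrite /= expr0n /=; lra.
have := sqrt_major_bound n; have := sqrt_major_bound n.+1.
rewrite [sqrt_major n.+2]/= [X in _ -> _ -> _ -> X <= _]/=.
set t := sqrt_major n; set t' := sqrt_major n.+1.
have -> : 2^-1 * (1 + t ^+ 2) = t' by [].
have e : t' = 2^-1 * (1 + t ^+ 2) by [].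
move=> /andP[a1 a2] /andP[b1 b2] h; rewrite [leLHS]e.
have : t ^+ 2 <= t' ^+ 2 by rewrite ler_pXn2r ?nnegrE.
lra.
Qed.

(** [a = 1 - s] satisfies [a^2 = 1 - (2 s - s^2) = b^2], and [a >= 0] since [s] is a
    contraction. *)
Lemma absolute_value b : bounded_op b -> adjoint b b ->
  (forall x, hnorm (b x) <= hnorm x) ->
  exists a : H -> H, [/\ bounded_op a, adjoint a a, forall x, a (a x) = b (b x),
    forall x, 0 <= rdot (a x) x
    & forall S, bounded_op S -> S \o b = b \o S -> S \o a = a \o S].
Proof.
move=> bb ab nb; pose s := sqrt_iter b; pose t := sqrt_major.
pose z x := x - b (b x).
have bz : bounded_op z := bop_sub (@bop_id R H) (bop_comp bb bb).
have nz x : hnorm (z x) <= hnorm x.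
  rewrite -(@ler_pXn2r _ 2) ?nnegrE ?hnorm_ge0 // !hnorm_sqr /z !rdotE.
  have e1 : rdot x (b (b x)) = rdot (b x) (b x) by rewrite -(adjoint_rdot _ _ ab).
  rewrite (rdotC (b (b x)) x) e1 -!hnorm_sqr.
  have := nb (b x); have := hnorm_ge0 (b (b x)); nra.
have sS n x : s n.+1 x = (2^-1 : R)%:C *: (z x + s n (s n x)) by [].
have bs n : bounded_op (s n).
  elim: n => [|n IHn]; first exact: bop_zero.
  exact: (bop_scale _ (bop_add bz (bop_comp IHn IHn))).
have az : adjoint z z.
  by move=> x y; rewrite /z hdotBl hdotBr !ab.
have asn n : adjoint (s n) (s n).
  elim: n => [|n IHn] x y; first by rewrite hdot0l hdot0r.
  by rewrite !sS hdotZl hdotZr_real hdotDl hdotDr az !IHn.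
have cs n S : bounded_op S -> S \o b = b \o S -> forall x, S (s n x) = s n (S x).
  move=> bS cS; have c x : S (b x) = b (S x) by exact: (congr1 (@^~ x) cS).
  elim: n => [|n IHn] x; first by rewrite /= (bop0 bS).
  by rewrite !sS (bopZ _ _ bS) (bopD _ _ bS) !IHn /z (bopB _ _ bS) !c.
have ns n x : hnorm (s n x) <= t n * hnorm x.
  elim: n x => [|n IHn] x; first by rewrite hnorm0 mul0r.
  rewrite sS hnormZr ger0_norm ?invr_ge0 // /t /= -/t -mulrA ler_pM2l ?invr_gt0 //.
  apply: le_trans (hnorm_leD _ _) _; rewrite mulrDl mul1r lerD //.
  have /andP[t0 _] := sqrt_major_bound n.
  apply: le_trans (IHn _) _; rewrite expr2 -mulrA ler_wpM2l //; exact: IHn.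
have ds n x : hnorm (s n.+1 x - s n x) <= (t n.+1 - t n) * hnorm x.
  elim: n x => [|n IHn] x.
    by rewrite subr0 [t 0%N]/= subr0; exact: ns.
  rewrite sS [s n.+1 x]sS -scalerBr.
  have -> : t n.+2 - t n.+1 = 2^-1 * (t n.+1 ^+ 2 - t n ^+ 2).
    have tS k : t k.+1 = 2^-1 * (1 + t k ^+ 2) by [].
    by have := tS n; have := tS n.+1; lra.
  rewrite hnormZr ger0_norm ?invr_ge0 // -mulrA ler_pM2l ?invr_gt0 //.
  have -> : z x + s n.+1 (s n.+1 x) - (z x + s n (s n x))
     = s n.+1 (s n.+1 x - s n x) + (s n.+1 (s n x) - s n (s n x)).
    by rewrite (bopB _ _ (bs n.+1)) opprD addrACA subrr add0r addrA subrK.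
  apply: le_trans (hnorm_leD _ _) _.
  have /andP[t0 _] := sqrt_major_bound n.
  have /andP[t1 _] := sqrt_major_bound n.+1.
  have h1 : hnorm (s n.+1 (s n.+1 x - s n x)) <= t n.+1 * ((t n.+1 - t n) * hnorm x).
    by apply: le_trans (ns _ _) _; rewrite ler_wpM2l.
  have h2 : hnorm (s n.+1 (s n x) - s n (s n x)) <= (t n.+1 - t n) * (t n * hnorm x).
    by apply: le_trans (IHn _) _; rewrite ler_wpM2l // subr_ge0 sqrt_major_le.
  by apply: le_trans (lerD h1 h2) _; rewrite le_eqVlt; apply/orP; left; apply/eqP; ring.
have tn : {homo t : n m / (n <= m)%N >-> n <= m}.
  by apply: homo_leq => // [? ? ?|]; [exact: le_trans|exact: sqrt_major_le].
have dst n m x : (n <= m)%N -> hnorm (s m x - s n x) <= (t m - t n) * hnorm x.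
  elim: m => [|m IHm]; first by rewrite leqn0 => /eqP ->; rewrite !subrr hnorm0 mul0r.
  rewrite leq_eqVlt => /predU1P[->|]; first by rewrite !subrr hnorm0 mul0r.
  rewrite ltnS => /IHm h.
  have -> : s m.+1 x - s n x = (s m.+1 x - s m x) + (s m x - s n x).
    by rewrite addrA subrK.
  by apply: le_trans (hnorm_leD _ _) _; have := ds m x; lra.
have ts : has_sup (range t).
  split; first by exists (t 0%N), 0%N.
  by exists 1 => _ [n _ <-]; have /andP[] := sqrt_major_bound n.
have /choice[r hr] : forall x, exists l, hlim (fun n => s n x) l.
  move=> x; apply: hilbert_seq_complete => e e0.
  have x1 : 0 < hnorm x + 1 by rewrite ltr_wpDl ?hnorm_ge0.
  have [_ [N _ <-] hN] := sup_adherent (divr_gt0 e0 x1) ts.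
  have key n m : (N <= n)%N -> (n <= m)%N -> hnorm (s m x - s n x) < e.
    move=> Nn nm; apply: le_lt_trans (dst _ _ _ nm) _.
    have h1 : t m <= sup (range t) by apply: ub_le_sup; [case: ts|exists m].
    have h2 := tn _ _ Nn.
    have h3 : t m - t n < e / (hnorm x + 1) by lra.
    have h4 : (t m - t n) * (hnorm x + 1) < e by rewrite -ltr_pdivlMr.
    have := tn _ _ nm; lra.
  exists N => n m Nn Nm; case: (leqP n m) => [nm|/ltnW mn]; last exact: key.
  by rewrite hdistC; exact: key.
have nr x : hnorm (r x) <= hnorm x.
  apply: hlim_norm_le (hr x) _ => n; apply: le_trans (ns _ _) _.
  by rewrite ler_piMl ?hnorm_ge0 //; have /andP[] := sqrt_major_bound n.
have br : bounded_op r.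
  apply: (@bounded_opI _ _ _ 1) => [x y|c x|x]; last by rewrite mul1r.
    apply: hlim_uniq (hr _) _.
    have := hlimD (hr x) (hr y).
    by congr hlim; apply/funext => n; rewrite (bopD _ _ (bs n)).
  apply: hlim_uniq (hr _) _.
  have := hlim_bop (bop_scale c (@bop_id R H)) (hr x).
  by congr hlim; apply/funext => n /=; rewrite (bopZ _ _ (bs n)).
have cr S : bounded_op S -> S \o b = b \o S -> forall x, S (r x) = r (S x).
  move=> bS cS x; apply: hlim_uniq (hr _).
  have := hlim_bop bS (hr x).
  by congr hlim; apply/funext => n /=; rewrite cs.
have ar : adjoint r r.
  have aux x y : rdot (r x) y = rdot x (r y).
    apply/eqP; rewrite -subr_eq0 -normr_eq0 eq_le normr_ge0 andbT.
    apply/ler_addgt0Pl => e e0; rewrite addr0.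
    have e2 : 0 < e / 2 by rewrite divr_gt0.
    have [N1 h1] := hlim_rdot (hr x) (fun=> erefl _ : rdot (s _ x) y = _) e2.
    have [N2 h2] := hlim_rdot (hr y) (fun=> erefl _ : rdot (s _ y) x = _) e2.
    have := h1 (maxn N1 N2) (leq_maxl _ _); have := h2 (maxn N1 N2) (leq_maxr _ _).
    rewrite (adjoint_rdot _ _ (asn _)) (rdotC y) (rdotC x (r y)) !ltr_norml.
    move=> /andP[p1 p2] /andP[q1 q2]; rewrite ler_norml; lra.
  move=> x y; rewrite !hdotE aux; congr (_ +i* _).
  by rewrite aux (bopZ _ _ br).
have rr x : r x = (2^-1 : R)%:C *: (z x + r (r x)).
  have l1 : hlim (fun n => s n (s n x)) (r (r x)).
    move=> e e0; have e2 : 0 < e / 2 by rewrite divr_gt0.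
    have [[N hN] [N' hN']] := (hr x _ e2, hr (r x) _ e2); exists (maxn N N') => n.
    rewrite geq_max => /andP[Nn N'n].
    have -> : s n (s n x) - r (r x) = s n (s n x - r x) + (s n (r x) - r (r x)).
      by rewrite (bopB _ _ (bs n)) addrA subrK.
    apply: le_lt_trans (hnorm_leD _ _) _.
    have : hnorm (s n (s n x - r x)) <= hnorm (s n x - r x).
      apply: le_trans (ns _ _) _; rewrite ler_piMl ?hnorm_ge0 //.
      by have /andP[] := sqrt_major_bound n.
    have := hN _ Nn; have := hN' _ N'n; lra.
  have l2 := hlim_bop (bop_scale (2^-1 : R)%:C (@bop_id R H)) (hlimD (hlim_cst (z x)) l1).
  apply: hlim_uniq l2 => e /(hr x)[N hN]; exists N => n Nn.
  by apply: (hN n.+1); exact: leqW.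
exists (fun x => x - r x); split.
- exact: (bop_sub (@bop_id R H) br).
- by move=> x y; rewrite hdotBl hdotBr ar.
- move=> x; have := rr x => /(congr1 (fun w => (2 : R)%:C *: w)).
  rewrite scalerA -rmorphM mulfV ?pnatr_eq0 // scale1r => e.
  have {}e : r x + r x = z x + r (r x).
    by rewrite -e (_ : (2 : R)%:C = 1 + 1) ?scalerDl ?scale1r // -rmorphD.
  rewrite (bopB _ _ br) opprB addrA [x - r x + _]addrAC -addrA -opprD e.
  by rewrite opprD addrACA subrr addr0 /z opprB addrC subrK.
- by move=> x; rewrite rdotBl subr_ge0 -hnorm_sqr expr2;
    apply: le_trans (rdot_CS _ _) _; rewrite ler_wpM2r ?hnorm_ge0.
- by move=> S bS cS; apply/funext => x /=; rewrite (bopB _ _ bS) (cr _ bS cS).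
Qed.

End AbsoluteValue.

(** * Spectral projections and commutators *)

Section SignProjection.
Context {R : realType} {H : hilbertSpace R}.
Implicit Types (S T b P : H -> H) (A : set (H -> H)) (x y z : H).

Definition contraction T : Prop := forall x, hnorm (T x) <= hnorm x.

(** [P] projects onto the kernel of [a - b], where [a] is the absolute value of [b]. On
    this kernel [b = a >= 0]; on its orthogonal complement [b = - a <= 0], because
    [(a - b) (a + b) = 0] sends the range of [a + b] into the kernel. *)
Lemma sign_projection A b : von_neumann_algebra A ->
  commutant A b -> adjoint b b -> contraction b ->
  exists P, [/\ projection P, commutant A P, P \o b = b \o P,
    forall x, 0 <= rdot (b (P x)) (P x)
    & forall x, rdot (b (x - P x)) (x - P x) <= 0].
Proof.
move=> vA [bb cb] ab nb.
have [a [ba aa a2 a0 ca]] := absolute_value bb ab nb.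
have cab x : b (a x) = a (b x) by exact: (congr1 (@^~ x) (ca _ bb (erefl _))).
pose K := [set x | a x = b x].
have bd : bounded_op (fun x => a x - b x) := bop_sub ba bb.
have cK : csubspace K.
  split=> [|x y|c x]; rewrite /K /=; first by rewrite (bop0 ba) (bop0 bb).
    by rewrite (bopD _ _ ba) (bopD _ _ bb) => -> ->.
  by rewrite (bopZ _ _ ba) (bopZ _ _ bb) => ->.
have lK : hclosed K.
  move=> x hx; apply: hnorm_ext => e e0; have [M M0 hM] := bop_bound bd.
  have M1 : 0 < M + 1 by rewrite ltr_wpDl.
  have [y Ky xy] := hx _ (divr_gt0 e0 M1).
  have -> : a x - b x = a (x - y) - b (x - y).
    by rewrite (bopB _ _ ba) (bopB _ _ bb) Ky opprB addrA subrK.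
  apply: le_lt_trans (hM _) _; move: xy; rewrite ltr_pdivlMr // => h.
  have := hnorm_ge0 (x - y); lra.
have cP S S' : bounded_op S -> bounded_op S' -> adjoint S S' ->
    S \o b = b \o S -> S' \o b = b \o S' -> S \o hproj K = hproj K \o S.
  move=> bS bS' SS' Sb S'b; apply: (hproj_commute cK lK bS SS') => x Kx.
    by rewrite /K /= -[a (S x)]/((a \o S) x) -(ca _ bS Sb) -[b (S x)]/((b \o S) x) -Sb /= Kx.
  by rewrite /K /= -[a (S' x)]/((a \o S') x) -(ca _ bS' S'b) -[b (S' x)]/((b \o S') x) -S'b /= Kx.
have Pb : b \o hproj K = hproj K \o b by apply: (cP _ b).
have Pa : a \o hproj K = hproj K \o a.
  by apply: (cP _ a) => //; apply/funext => x /=; rewrite cab.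
exists (hproj K); split.
- exact: hproj_projection.
- split; first exact: hproj_bounded.
  move=> S AS; have bS := vN_bounded vA AS; have [S' bS' SS'] := adjoint_exists bS.
  have AS' := vN_selfadjoint vA AS bS' SS'.
  by symmetry; apply: (cP S S') => //; symmetry; exact: cb.
- by [].
- by move=> x; have := hproj_in cK lK x; rewrite {1}/K /= => <-; exact: a0.
move=> x; set w := x - hproj K x.
have w0 : hproj K w = 0.
  by rewrite /w (bopB _ _ (hproj_bounded cK lK)) hproj_idem // subrr.
have : a w + b w = 0.
  have Kw : K (a w + b w).
    by rewrite /K /= (bopD _ _ ba) (bopD _ _ bb) a2 cab addrC.
  rewrite -(hproj_id cK lK Kw) (bopD _ _ (hproj_bounded cK lK)).
  rewrite -[hproj K (a w)]/((hproj K \o a) w) -Pa -[hproj K (b w)]/((hproj K \o b) w) -Pb /= w0.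
  by rewrite (bop0 ba) (bop0 bb) addr0.
move=> /eqP; rewrite addrC addr_eq0 => /eqP ->.
by rewrite rdotNl oppr_le0; exact: a0.
Qed.

(** Polarization bounds a self-adjoint operator by its quadratic form. *)
Lemma selfadjoint_contraction b : bounded_op b -> adjoint b b ->
  (forall x, `|rdot (b x) x| <= hnorm x ^+ 2) -> contraction b.
Proof.
move=> bb ab h x.
have [->|/hnorm_gt0 b0] := eqVneq (b x) 0; first by rewrite hnorm0 hnorm_ge0.
(* The polarized form is evaluated at a multiple of [b x] of the same norm as [x]. *)
pose y := (hnorm x / hnorm (b x))%:C *: b x.
have ny : hnorm y = hnorm x.
  by rewrite hnormZr ger0_norm ?divr_ge0 ?hnorm_ge0 // divfK // gt_eqF.
have e : rdot (b x) y = hnorm x * hnorm (b x).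
  by rewrite rdotZr -hnorm_sqr expr2 mulrA divfK // gt_eqF.
have p : 4 * rdot (b x) y
    = rdot (b (x + y)) (x + y) - rdot (b (x - y)) (x - y).
  rewrite (bopD _ _ bb) (bopB _ _ bb) !rdotDl !rdotDr !rdotNl !rdotNr.
  by rewrite (adjoint_rdot y x ab) (rdotC y); ring.
have h1 := h (x + y); have h2 := h (x - y); have h3 := parallelogram x y.
move: h1 h2; rewrite !ler_norml => /andP[_ h1] /andP[h2 _].
have [x0|x0] := eqVneq (hnorm x) 0.
  by rewrite (hnorm_eq0 x0) (bop0 bb) hnorm0.
have {}x0 : 0 < hnorm x by rewrite lt_neqAle eq_sym x0 hnorm_ge0.
rewrite -(ler_pM2l x0) -e -expr2; rewrite ny in h3; lra.
Qed.

Lemma ann_projection A P x y : von_neumann_algebra A -> commutant A P ->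
  adjoint P P -> P y = 0 -> ann A (P x) y.
Proof.
move=> vA [_ cP] aP Py S AS.
by rewrite -[S (P x)]/((S \o P) x) -(cP _ AS) /= aP Py hdot0r.
Qed.

Lemma projection_idem P x : projection P -> P (P x) = P x.
Proof. by move=> [_ PP _]; exact: (congr1 (@^~ x) PP). Qed.

Lemma projection_pythagoras P x : projection P ->
  hnorm x ^+ 2 = hnorm (P x) ^+ 2 + hnorm (x - P x) ^+ 2.
Proof.
move=> pP; have [bP _ aP] := pP.
have e : rdot x (P x) = hnorm (P x) ^+ 2.
  by rewrite -(adjoint_rdot _ _ aP) hnorm_sqr -[RHS](adjoint_rdot _ _ aP)
     projection_idem.
by rewrite (hnorm_sqr (x - P x)) rdotBl !rdotBr (rdotC (P x) x) e -!hnorm_sqr; ring.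
Qed.

Lemma projection_contraction P x : projection P ->
  hnorm (P x) <= hnorm x /\ hnorm (x - P x) <= hnorm x.
Proof.
move=> pP; split; rewrite -(@ler_pXn2r _ 2) ?nnegrE ?hnorm_ge0 //
  (projection_pythagoras x pP) ?lerDl ?lerDr sqr_ge0 //.
Qed.

Definition commutator_form T b x y : R := rdot (T (b x)) y - rdot (T x) (b y).

(** The commutator of [T] and [P] has two off-diagonal blocks, and each of them pairs
    the range of [P] with the range of [1 - P], which [A] keeps orthogonal. *)
Lemma commutator_projection A T c P : von_neumann_algebra A -> 0 <= c ->
  bounded_op T -> rank_one_bound A T c -> projection P -> commutant A P ->
  forall x y, commutator_form T P x y <= 2 * c * hnorm x * hnorm y.
Proof.
move=> vA c0 bT hc pP cP x y; have [bP _ aP] := pP.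
have idP z : P (z - P z) = 0 by rewrite (bopB _ _ bP) projection_idem // subrr.
have a1 : ann A (P x) (y - P y) by exact: ann_projection.
have a2 : ann A (P x - x) (P y).
  move=> S AS; rewrite -aP.
  have -> : P (S (P x - x)) = S (P (P x - x)).
    by rewrite -[LHS]/((P \o S) _); have [_ ->] := cP.
  by rewrite -opprB (bopN _ bP) idP oppr0 (bop0 (vN_bounded vA AS)) hdot0l.
have -> : commutator_form T P x y
    = rdot (T (P x)) (y - P y) + rdot (T (P x - x)) (P y).
  by rewrite /commutator_form (bopB _ _ bT) rdotBl rdotBr; ring.
have [p1 p2] := projection_contraction x pP.
have [q1 q2] := projection_contraction y pP.
have h1 : hnorm (P x) * hnorm (y - P y) <= hnorm x * hnorm y.
  by rewrite ler_pM ?hnorm_ge0.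
have h2 : hnorm (P x - x) * hnorm (P y) <= hnorm x * hnorm y.
  by rewrite hdistC ler_pM ?hnorm_ge0.
apply: le_trans (lerD (hc _ _ a1) (hc _ _ a2)) _.
rewrite -!mulrA; have := ler_wpM2l c0 h1; have := ler_wpM2l c0 h2; lra.
Qed.

(** With [P] the sign projection of [b], subtracting the symmetry [2 P - 1] from [2 b]
    stretches the parts of the spectrum of [b] in [[-1, 0]] and in [[0, 1]] to
    [[-1, 1]]. *)
Lemma halve_selfadjoint A b : von_neumann_algebra A ->
  commutant A b -> adjoint b b -> contraction b ->
  exists P b', [/\ projection P, commutant A P,
    [/\ commutant A b', adjoint b' b' & contraction b']
    & forall x, b x = (2^-1 : R)%:C *: (b' x - x) + P x].
Proof.
move=> vA cb ab nb; have [bb _] := cb.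
have [P [pP cP Pb Pge Ple]] := sign_projection vA cb ab nb.
have [bP _ aP] := pP.
pose b' x := (2 : R)%:C *: (b x - P x) + x.
have vA' := vN_commutant vA.
have cb' : commutant A b'.
  have [_ _ D Z] := vN_subspace vA'; have [[_ I _ _] _] := vA'.
  have -> : b' = fun x => (fun x => (2 : R)%:C *: (b x + (-1) *: P x)) x + id x.
    by apply/funext => x; rewrite /b' scaleN1r.
  by apply: (D) => //; apply: (Z); apply: (D) => //; exact: (Z).
have ab' : adjoint b' b'.
  move=> x y; by rewrite /b' !hdotDl !hdotDr hdotZl hdotZr_real !hdotBl !hdotBr ab aP.
exists P, b'; split=> //; last first.
  move=> x; rewrite /b' addrK scalerA -rmorphM mulVf ?pnatr_eq0 // scale1r.
  by rewrite subrK.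
split=> //; apply: selfadjoint_contraction => //; first by case: cb'.
move=> x; rewrite (projection_pythagoras x pP).
set p := P x; set q := x - P x.
have xE : x = p + q by rewrite /p /q addrC subrK.
have Pp : P p = p by exact: projection_idem.
have Pq : P q = 0 by rewrite /q (bopB _ _ bP) projection_idem // subrr.
have cr z w : P z = z -> P w = 0 -> rdot (b z) w = 0.
  move=> Pz Pw; rewrite -Pz -[b (P z)]/((b \o P) z) -Pb /= (adjoint_rdot _ _ aP).
  by rewrite Pw rdot0r.
have crpq := cr _ _ Pp Pq.
have crqp : rdot (b q) p = 0 by rewrite (adjoint_rdot _ _ ab) rdotC.
have pq : rdot p q = 0 by rewrite -Pp (adjoint_rdot _ _ aP) Pq rdot0r.
have e : rdot (b' x) x = 2 * rdot (b p) p + 2 * rdot (b q) q - hnorm p ^+ 2 + hnorm q ^+ 2.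
  rewrite /b' -/p; clearbody p q; rewrite {}xE (bopD _ _ bb) !hnorm_sqr.
  rewrite !(rdotDl, rdotDr, rdotZl, rdotNl) crpq crqp (rdotC q p) pq; ring.
have bp : rdot (b p) p <= hnorm p ^+ 2.
  apply: le_trans (rdot_CS _ _) _; rewrite expr2 ler_wpM2r ?hnorm_ge0 //; exact: nb.
have bq : - rdot (b q) q <= hnorm q ^+ 2.
  rewrite -rdotNl; apply: le_trans (rdot_CS _ _) _.
  by rewrite hnorm_opp expr2 ler_wpM2r ?hnorm_ge0 //; exact: nb.
have := Pge x; have := Ple x; rewrite -/p -/q => h1 h2.
rewrite ler_norml e; apply/andP; split; lra.
Qed.

(** The commutator of [T] with [b] is the one with [P] plus half the one with a
    contraction [b'] of the same kind. Iterating [n] times leaves a geometric series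
    bounded by [4 c] and a remainder [2 M / 2^n]. This replaces the norm-convergent
    expansion of [b] into spectral projections. *)
Lemma commutator_selfadjoint_iter A T c M n : von_neumann_algebra A -> 0 <= c ->
  bounded_op T -> rank_one_bound A T c ->
  0 <= M -> (forall x, hnorm (T x) <= M * hnorm x) ->
  forall b, commutant A b -> adjoint b b -> contraction b ->
  forall x y, commutator_form T b x y
    <= (4 * c + 2 * M / 2 ^+ n) * (hnorm x * hnorm y).
Proof.
move=> vA c0 bT hc M0 hM; elim: n => [|n IHn] b cb ab nb x y.
  rewrite expr0 divr1 /commutator_form.
  have h1 : rdot (T (b x)) y <= M * (hnorm x * hnorm y).
    apply: le_trans (rdot_CS _ _) _; rewrite mulrA ler_wpM2r ?hnorm_ge0 //.
    by apply: le_trans (hM _) _; rewrite ler_wpM2l.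
  have h2 : - rdot (T x) (b y) <= M * (hnorm x * hnorm y).
    rewrite -rdotNl; apply: le_trans (rdot_CS _ _) _; rewrite hnorm_opp mulrA.
    by rewrite ler_pM ?hnorm_ge0 ?mulr_ge0.
  have := mulr_ge0 c0 (mulr_ge0 (hnorm_ge0 x) (hnorm_ge0 y)); lra.
have [P [b' [pP cP [cb' ab' nb'] bE]]] := halve_selfadjoint vA cb ab nb.
have -> : commutator_form T b x y
    = commutator_form T P x y + 2^-1 * commutator_form T b' x y.
  rewrite /commutator_form !bE !(bopD _ _ bT) (bopZ _ _ bT) (bopB _ _ bT).
  by rewrite !(rdotDl, rdotDr, rdotZl, rdotZr, rdotNl, rdotNr); ring.
have h1 := commutator_projection vA c0 bT hc pP cP x y.
have h2 := IHn _ cb' ab' nb' x y.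
have -> : 2 * M / 2 ^+ n.+1 = 2^-1 * (2 * M / 2 ^+ n).
  by rewrite exprS; field; rewrite expf_neq0 ?pnatr_eq0.
rewrite -mulrA in h1; nra.
Qed.

Lemma commutator_selfadjoint A T c b : von_neumann_algebra A -> 0 <= c ->
  bounded_op T -> rank_one_bound A T c ->
  commutant A b -> adjoint b b -> contraction b ->
  forall x y, commutator_form T b x y <= 4 * c * (hnorm x * hnorm y).
Proof.
move=> vA c0 bT hc cb ab nb x y; have [M M0 hM] := bop_bound bT.
apply/ler_addgt0Pl => e e0.
have xy0 := mulr_ge0 (hnorm_ge0 x) (hnorm_ge0 y).
pose D := 2 * M * (hnorm x * hnorm y); have D0 : 0 <= D.
  by rewrite !mulr_ge0 ?hnorm_ge0.
have [n hn] : exists n, D < e * 2 ^+ n.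
  exists (Num.truncn (D / e)).+1; rewrite mulrC -ltr_pdivrMr //.
  apply: lt_trans (truncnS_gt _) _; rewrite -natrX ltr_nat; exact: ltn_expl.
apply: le_trans (commutator_selfadjoint_iter n vA c0 bT hc M0 hM cb ab nb x y) _.
rewrite mulrDl addrC lerD2r; rewrite /D in hn.
have p2 : (0 : R) < 2 ^+ n by rewrite exprn_gt0.
by rewrite mulrAC ler_pdivrMr // ltW.
Qed.

(** Real and imaginary parts of [g] are self-adjoint contractions. *)
Lemma commutator_contraction A T c g g' : von_neumann_algebra A -> 0 <= c ->
  bounded_op T -> rank_one_bound A T c ->
  commutant A g -> bounded_op g' -> adjoint g g' -> contraction g ->
  forall x y, rdot (T (g x)) y - rdot (T x) (g' y) <= 8 * c * (hnorm x * hnorm y).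
Proof.
move=> vA c0 bT hc cg bg' gg' ng x y.
have vA' := vN_commutant vA; have [bg _] := cg.
have cg' := vN_selfadjoint vA' cg bg' gg'.
have ng' : contraction g'.
  move=> z; apply: hnorm_le_dual => [|w]; first exact: hnorm_ge0.
  rewrite rdotC -(adjoint_rdot _ _ gg') mulrC; apply: le_trans (rdot_CS _ _) _.
  by rewrite ler_wpM2r ?hnorm_ge0.
have [_ _ D Z] := vN_subspace vA'.
pose h z := (2^-1 : R)%:C *: (g z + g' z).
pose k z := (2^-1 : R)%:C *: ('i *: (g' z + (-1) *: g z)).
have ch : commutant A h by apply: (Z); exact: (D).
have ck : commutant A k.
  by apply: (Z); apply: (Z); apply: (D) => //; exact: (Z).
have ah : adjoint h h.
  move=> u v; rewrite /h hdotZl hdotZr_real hdotDl hdotDr gg' (adjointC gg').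
  by congr (_ * _); rewrite addrC.
have ak : adjoint k k.
  move=> u v; rewrite /k !scaleN1r !hdotZl hdotZr_real hdotZr_i hdotBl hdotBr.
  by rewrite gg' (adjointC gg'); congr (_ * _); rewrite mulNr -mulrN opprB.
have i1 : complex.Re `|('i : R[i])%C| = 1.
  by rewrite normc_def /= expr0n /= add0r expr1n sqrtr1.
have nh : contraction h.
  move=> z; rewrite /h hnormZr ger0_norm ?invr_ge0 //.
  have := hnorm_leD (g z) (g' z); have := ng z; have := ng' z; lra.
have nk : contraction k.
  move=> z; rewrite /k hnormZr ger0_norm ?invr_ge0 // hnormZ i1 scaleN1r.
  have := hnorm_leB (g' z) (g z); have := ng z; have := ng' z; lra.
have h1 := commutator_selfadjoint vA c0 bT hc ch ah nh x y.
have h2 := commutator_selfadjoint vA c0 bT hc ck ak nk x (- ('i *: y)).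
rewrite hnorm_opp hnormZ i1 mul1r in h2.
have half (w : H) : (2^-1 : R)%:C *: (w + w) = w.
  have h12 : 2^-1 + 2^-1 = 1 :> R by lra.
  by rewrite scalerDr -scalerDl -rmorphD h12 scale1r.
have gE z : g z = h z + 'i *: k z.
  have -> : 'i *: k z = (2^-1 : R)%:C *: (g z - g' z).
    rewrite /k scaleN1r !scalerA mulrAC -expr2 sqr_i mulN1r.
    by rewrite scaleNr -scalerN opprB.
  by rewrite /h -scalerDr addrACA subrr addr0 half.
have g'E z : g' z = h z - 'i *: k z.
  have -> : 'i *: k z = g z - h z by rewrite gE addrC addKr.
  rewrite opprB addrA /h -scalerDr half.
  by rewrite addrC addKr.
have kr z w : rdot z ('i *: w) = - rdot ('i *: z) w.
  by rewrite rdot_i opprK.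
clearbody h k; move: h1 h2; rewrite /commutator_form gE g'E.
rewrite (bopD _ _ bT) (bopZ _ _ bT) (bopN _ ck.1) (bopZ _ _ ck.1).
rewrite !(rdotDl, rdotDr, rdotNl, rdotNr) !kr; lra.
Qed.

Lemma four_term_sum {F : realFieldType} (a1 a2 a3 a4 b1 b2 b3 b4 C : F) :
  a1 - b1 <= C -> a2 - b3 <= C -> a3 - b2 <= C -> a4 - b4 <= C ->
  a1 + a2 + (a3 + a4) - (b1 + b2 + (b3 + b4)) <= 4 * C.
Proof. by move=> ? ? ? ?; lra. Qed.

(** A pair [u, v] annihilating the operators [S (+) S] is separated by the projection
    [P] onto the closure of the orbit of [u]: [P u = u] and [P v = 0]. So the form of
    [T (+) T] at [u, v] is that of its commutator with [P], hence the sum of four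
    commutators of [T] with matrix entries of [P]; these entries are contractions in
    the commutant of [A]. *)
Lemma rank_two_bound A T c : von_neumann_algebra A -> 0 <= c ->
  bounded_op T -> rank_one_bound A T c ->
  rank_one_bound [set dsum S | S in A] (dsum T) (32 * c).
Proof.
move=> vA c0 bT hc u v a; have [[[Ab A0 AD AZ] A1 AM As] _] := vA.
pose K := hclosure [set dsum S u | S in A].
have cK : csubspace K.
  apply: hclosure_csubspace; split.
  - by exists (fun=> 0).
  - move=> _ _ [S AS <-] [S' AS' <-].
    by exists (fun x => S x + S' x); [exact: AD|rewrite /dsum hpairD].
  - move=> d _ [S AS <-].
    by exists (fun x => d *: S x); [exact: AZ|rewrite /dsum hpairZ].
have lK : hclosed K by exact: hclosure_closed.
pose P := hproj K.
have Pu : P u = u.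
  apply: hproj_id => //; apply: sub_hclosure; exists id => //.
  by rewrite /dsum hpair_eta.
have Pv : P v = 0.
  apply: hproj_perp => // k Kk; rewrite hdotC (@orthogonal_hclosure _ _ _ v _ _ Kk) ?conjc0 //.
  by move=> _ [S AS <-]; apply: a; exists S.
have bP : bounded_op P by exact: hproj_bounded.
have aP : adjoint P P by exact: hproj_adj.
have KS S : A S -> forall w, K w -> K (dsum S w).
  move=> AS; apply: hclosure_invariant; first exact/dsum_bounded/Ab.
  by move=> _ [S' AS' <-]; exists (S \o S'); [exact: AM|].
have cP S : A S -> dsum S \o P = P \o dsum S.
  move=> AS; have bS := Ab _ AS; have [S' bS' SS'] := adjoint_exists bS.
  apply: (@hproj_commute _ _ _ cK lK _ (dsum S')).
  - exact: dsum_bounded.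
  - exact: dsum_adjoint.
  - exact: KS.
  - by apply: KS; exact: As SS'.
(* [true] stands for the first coordinate, [false] for the second. *)
pose inj (j : bool) (x : H) : hsquare H := if j then hpair x 0 else hpair 0 x.
pose pr (i : bool) (w : hsquare H) : H := if i then hfst w else hsnd w.
pose p i j x := pr i (P (inj j x)).
have injD j x y : inj j (x + y) = inj j x + inj j y.
  by case: j; rewrite /inj hpairD addr0.
have injZ j d x : inj j (d *: x) = d *: inj j x.
  by case: j; rewrite /inj hpairZ scaler0.
have prD i w w' : pr i (w + w') = pr i w + pr i w' by case: i.
have prZ i d w : pr i (d *: w) = d *: pr i w by case: i.
have ninj j x : hnorm (inj j x) = hnorm x.
  by case: j; rewrite /inj ?hnorm_inl ?hnorm_inr.
have npr i w : hnorm (pr i w) <= hnorm w.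
  by case: i; [exact: hfst_norm|exact: hsnd_norm].
have np i j : contraction (p i j).
  move=> x; rewrite /p -(ninj j x); apply: le_trans (npr _ _) _.
  exact: hproj_norm.
have bp i j : bounded_op (p i j).
  apply: (@bounded_opI _ _ _ 1) => [x y|d x|x].
  - by rewrite /p injD (bopD _ _ bP) prD.
  - by rewrite /p injZ (bopZ _ _ bP) prZ.
  - by rewrite mul1r; exact: np.
have cp i j : commutant A (p i j).
  split=> // S AS; have bS := Ab _ AS; apply/funext => x /=.
  have e1 : inj j (S x) = dsum S (inj j x).
    by case: (j); rewrite /inj /dsum hfst_pair hsnd_pair (bop0 bS).
  have e2 w : S (pr i w) = pr i (dsum S w) by case: (i).
  by rewrite /p e1 e2 -[P (dsum S _)]/((P \o dsum S) _) -(cP _ AS).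
have ap i j : adjoint (p i j) (p j i).
  have e w i' y : hdot (pr i' w) y = hdot w (inj i' y).
    by case: i'; rewrite /= hdot_square hfst_pair hsnd_pair hdot0r ?addr0 ?add0r.
  by move=> x y; rewrite /p e aP hdotC -e -hdotC.
have PE w i : pr i (P w) = p i true (hfst w) + p i false (hsnd w).
  by rewrite /p -prD -(bopD _ _ bP) /= hpairD addr0 add0r hpair_eta.
have key i j : rdot (T (p i j (pr j u))) (pr i v) - rdot (T (pr j u)) (p j i (pr i v))
    <= 8 * c * (hnorm u * hnorm v).
  apply: le_trans (commutator_contraction vA c0 bT hc (cp i j) (bp j i) (ap i j) (np i j) _ _) _.
  by rewrite ler_wpM2l ?mulr_ge0 // ler_pM ?hnorm_ge0.
have -> : rdot (dsum T u) v = rdot (dsum T (P u)) v - rdot (dsum T u) (P v).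
  by rewrite Pu Pv rdot0r subr0.
rewrite !rdot_square /dsum !hfst_pair !hsnd_pair.
have PE1 w : hfst (P w) = p true true (hfst w) + p true false (hsnd w) := PE w true.
have PE2 w : hsnd (P w) = p false true (hfst w) + p false false (hsnd w) := PE w false.
clearbody p P; rewrite !PE1 !PE2 !(bopD _ _ bT) !rdotDl !rdotDr.
have -> : 32 * c * hnorm u * hnorm v = 4 * (8 * c * (hnorm u * hnorm v)) by ring.
exact: four_term_sum (key true true) (key true false) (key false true) (key false false).
Qed.

Lemma distance_estimate_diagonal A k : von_neumann_algebra A ->
  distance_estimate [set dsum S | S in A] k -> distance_estimate A (k * 32).
Proof.
move=> vA hk T c bT c0 hc d cd.
have [||_ [S AS <-] hS] := hk (dsum T) (32 * c) (dsum_bounded bT) _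
    (rank_two_bound vA c0 bT hc) d.
- by rewrite mulr_ge0.
- by rewrite mulrA.
exists S => // x; rewrite -(hnorm_inl x) ; apply: le_trans (hS _).
exact: (hfst_norm (dsum T (hpair x 0) - dsum S (hpair x 0))).
Qed.

(** If [T] generates the commutant of [A], then the three projections attached to [T]
    have as common commutant the operators [S (+) S] with [S] in [A]. *)
Lemma hyperreflexive_of_projection_commutants A :
  (forall Q : 'I_3 -> hsquare H -> hsquare H, (forall i, projection (Q i)) ->
     hyperreflexive (\bigcap_(i in [set: 'I_3]) commutant [set Q i])) ->
  von_neumann_algebra A -> singly_generated (commutant A) -> hyperreflexive A.
Proof.
move=> commutant_hyp vA [T bT AE].
have := commutant_hyp (graph_proj T) (fun i => graph_proj_projection i bT).
rewrite bigcap_commutant // commutant_graph_proj // -AE vN_bicommutant //.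
move=> /hyperreflexive_distance_estimate[k k0 hk].
apply: distance_estimate_hyperreflexive => //; exists (k * 32); first exact: mulr_gt0.
exact: distance_estimate_diagonal.
Qed.

End SignProjection.

(** * Weak compactness *)

Section UltraLimit.
Context {R : realType} {I : Type} (U : set_system I).
Hypothesis UU : UltraFilter U.
Implicit Types (f g : I -> R) (l m a C : R).

Let UF : ProperFilter U := ultra_proper.

Definition ultra_lim f l : Prop :=
  forall e, 0 < e -> U [set i | `|f i - l| < e].

Lemma ultra_lim_exists f C : U [set i | `|f i| <= C] -> exists l, ultra_lim f l.
Proof.
move=> UC; pose E := [set a | U [set i | a <= f i]].
have Ehs : has_sup E.
  split; first by exists (- C); apply: filterS UC => i /=; rewrite ler_norml => /andP[].
  exists C => a Ea; have [i [/= h1 h2]] := filter_ex (filterI UC Ea).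
  by apply: le_trans h2 _; apply: le_trans (ler_norm _) h1.
exists (sup E) => e e0.
have [a Ea la] := sup_adherent e0 Ehs.
have : U [set i | f i < sup E + e].
  have [h|] := in_ultra_setVsetC [set i | sup E + e <= f i] UU.
    suff : sup E + e <= sup E by rewrite gerDl leNgt e0.
    by apply: ub_le_sup h; case: Ehs.
  by apply: filterS => i /= /negP; rewrite -ltNge.
apply: filterS2 Ea => i /= h1 h2; rewrite ltr_norml; apply/andP; split; lra.
Qed.

Lemma ultra_lim_uniq f l m : ultra_lim f l -> ultra_lim f m -> l = m.
Proof.
move=> fl fm; apply/eqP; rewrite -subr_eq0 -normr_eq0 eq_le normr_ge0 andbT.
apply/ler_addgt0Pl => e e0; rewrite addr0; have e2 : 0 < e / 2 by rewrite divr_gt0.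
have [i [/= h1 h2]] := filter_ex (filterI (fl _ e2) (fm _ e2)).
move: h1 h2; rewrite !ltr_norml ler_norml => /andP[? ?] /andP[? ?].
by apply/andP; split; lra.
Qed.

Lemma ultra_lim_ext f g l : U [set i | f i = g i] -> ultra_lim f l -> ultra_lim g l.
Proof. by move=> fg fl e /fl; apply: filterS2 fg => i /= ->. Qed.

Lemma ultra_lim_cst a : ultra_lim (fun=> a) a.
Proof. by move=> e e0; apply: filterE => i /=; rewrite subrr normr0. Qed.

Lemma ultra_limD f g l m : ultra_lim f l -> ultra_lim g m ->
  ultra_lim (fun i => f i + g i) (l + m).
Proof.
move=> fl gm e e0; have e2 : 0 < e / 2 by rewrite divr_gt0.
apply: filterS2 (fl _ e2) (gm _ e2) => i /= h1 h2.
rewrite opprD addrACA; apply: le_lt_trans (ler_normD _ _) _; lra.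
Qed.

Lemma ultra_limZ f a l : ultra_lim f l -> ultra_lim (fun i => a * f i) (a * l).
Proof.
move=> fl e e0; have a1 : 0 < `|a| + 1 by rewrite ltr_wpDl.
apply: filterS (fl _ (divr_gt0 e0 a1)) => i /=; rewrite ltr_pdivlMr // => h.
rewrite -mulrBr normrM; have := normr_ge0 (f i - l); nra.
Qed.

Lemma ultra_lim_le f l C : U [set i | `|f i| <= C] -> ultra_lim f l -> `|l| <= C.
Proof.
move=> UC fl; apply/ler_addgt0Pl => e e0.
have [i [/= h1 h2]] := filter_ex (filterI UC (fl _ e0)).
have -> : l = f i - (f i - l) by ring.
by apply: le_trans (ler_normB _ _) _; lra.
Qed.

End UltraLimit.

Section WeakCompactness.
Context {R : realType} {H : hilbertSpace R}.
Implicit Types (S T f : H -> H) (A F : set (H -> H)) (V : set H) (x y z : H).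

(** Approximating [T] up to [d] and commuting with [F], tested on matrix entries at
    vectors of [V]: the form in which these conditions survive weak limits and
    extension from a subspace containing [V]. *)
Definition approx_commuting T d F V S : Prop :=
  (forall x y, V x -> V y -> `|rdot (T x - S x) y| <= d * hnorm x * hnorm y) /\
  (forall f x y, F f -> V x -> V y -> rdot (S (f x)) y = rdot (f (S x)) y).

(** Bounded sets of operators are compact for the weak operator topology. The pairs of
    countable sets are directed by inclusion, and the weak limit of the local
    solutions along an ultrafilter refining this order commutes with all of [A']. *)
Lemma weak_compactness A T d : von_neumann_algebra A -> bounded_op T -> 0 <= d ->
  (forall F V, countable F -> countable V -> F `<=` commutant A ->
     exists2 S, bounded_op S & approx_commuting T d F V S) ->
  exists2 S, A S & forall x, hnorm (T x - S x) <= d * hnorm x.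
Proof.
move=> vA bT d0 loc; have [M M0 hM] := bop_bound bT.
have bA' f : commutant A f -> bounded_op f by case.
pose index := (set (H -> H) * set H)%type.
(* An index consists of countably many operators to commute with and countably many
   test vectors. *)
pose good (i : index) := [/\ countable i.1, countable i.2 & i.1 `<=` commutant A].
have /choice[S hS] : forall i : index, exists S, bounded_op S /\
    (good i -> approx_commuting T d i.1 i.2 S).
  move=> i; have [[c1 c2 s]|ng] := pselect (good i).
    by have [S bS hS] := loc _ _ c1 c2 s; exists S.
  by exists id; split; [exact: bop_id|].
have bS i : bounded_op (S i) by case: (hS i).
pose above (i j : index) := [/\ good j, i.1 `<=` j.1 & i.2 `<=` j.2].
pose G : set_system index := [set P | exists2 i, good i & above i `<=` P].
have good0 : good (set0, set0) by split; [exact: countable0|exact: countable0|].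
have FG : ProperFilter G.
  apply: Build_ProperFilter_ex.
    by move=> P [i gi iP]; exists i; apply: iP; split.
  split.
  - by exists (set0, set0).
  - move=> P Q [i gi iP] [j gj jQ]; exists (i.1 `|` j.1, i.2 `|` j.2).
      have [[a1 a2 a3] [b1 b2 b3]] := (gi, gj); split=> /=.
      + by rewrite -bigcup2inE; apply: bigcup_countable => // -[|[|]].
      + by rewrite -bigcup2inE; apply: bigcup_countable => // -[|[|]].
      + by move=> f [/a3|/b3].
    move=> k [gk s1 s2]; split; [apply: iP|apply: jQ]; split=> // z hz.
    + by apply: s1; left.
    + by apply: s2; left.
    + by apply: s1; right.
    + by apply: s2; right.
  - by move=> P Q PQ [i gi iP]; exists i => //; exact: subset_trans PQ.
have [U [UU GU]] := ultraFilterLemma FG.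
have UF : ProperFilter U := ultra_proper.
have evV x : U [set i | good i /\ i.2 x].
  apply: GU; exists (set0, [set x]); first by split; [exact: countable0|exact: countable1|].
  by move=> i [gi _ h]; split=> //; exact: h.
have evF f : commutant A f -> U [set i | good i /\ i.1 f].
  move=> Af; apply: GU; exists ([set f], set0).
    by split; [exact: countable1|exact: countable0|move=> _ ->].
  by move=> i [gi h _]; split=> //; exact: h.
have bnd x y : U [set i | `|rdot (S i x) y| <= (M + d) * hnorm x * hnorm y].
  apply: filterS2 (evV x) (evV y) => i /= [gi Vx] [_ Vy].
  have [/(_ _ _ Vx Vy) h _] := (hS i).2 gi.
  have -> : rdot (S i x) y = rdot (T x) y - rdot (T x - S i x) y.
    by rewrite rdotBl; ring.
  apply: le_trans (ler_normB _ _) _; rewrite !mulrDl lerD //.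
  by apply: le_trans (norm_rdot_CS _ _) _; rewrite ler_wpM2r ?hnorm_ge0.
have /choice[L hL] : forall xy : H * H,
    exists l, ultra_lim U (fun i => rdot (S i xy.1) xy.2) l.
  by move=> [x y]; exact: (ultra_lim_exists UU (bnd x y)).
pose s x y := L (x, y).
have hs x y : ultra_lim U (fun i => rdot (S i x) y) (s x y) := hL (x, y).
have sE x y l : ultra_lim U (fun i => rdot (S i x) y) l -> s x y = l.
  exact: ultra_lim_uniq.
have /choice[W hW] : forall x, exists v, forall y, s x y = rdot v y.
  move=> x.
  have [|||||v _ hv] := @riesz_closed _ _ setT (s x) ((M + d) * hnorm x).
  - by split.
  - by [].
  - move=> y z; apply: sE; apply: ultra_lim_ext (ultra_limD UU (hs x y) (hs x z)).
    by apply: filterE => i /=; rewrite rdotDr.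
  - move=> a y; apply: sE; apply: ultra_lim_ext (ultra_limZ UU a (hs x y)).
    by apply: filterE => i /=; rewrite rdotZr.
  - by move=> y; exact: (ultra_lim_le UU (bnd x y) (hs x y)).
  by exists v => y; exact: hv.
have WE x y l : ultra_lim U (fun i => rdot (S i x) y) l -> rdot (W x) y = l.
  by rewrite -hW; exact: sE.
have hW' x y : ultra_lim U (fun i => rdot (S i x) y) (rdot (W x) y).
  by rewrite -hW.
have WD x y : W (x + y) = W x + W y.
  apply: rdot_ext => z; rewrite rdotDl; apply: WE.
  apply: ultra_lim_ext (ultra_limD UU (hW' x z) (hW' y z)).
  by apply: filterE => i /=; rewrite (bopD _ _ (bS i)) rdotDl.
have WZr (a : R) x : W (a%:C *: x) = a%:C *: W x.
  apply: rdot_ext => z; rewrite rdotZl; apply: WE.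
  apply: ultra_lim_ext (ultra_limZ UU a (hW' x z)).
  by apply: filterE => i /=; rewrite (bopZ _ _ (bS i)) rdotZl.
have WI x : W ('i *: x) = 'i *: W x.
  apply: rdot_ext => z; rewrite rdot_i -rdotNr; apply: WE.
  apply: ultra_lim_ext (hW' x (- ('i *: z))).
  by apply: filterE => i /=; rewrite (bopZ _ _ (bS i)) rdot_i rdotNr.
have WZ c x : W (c *: x) = c *: W x.
  by rewrite [c]complexE !scalerDl -!scalerA WD WZr WI WZr.
have Wd x : hnorm (T x - W x) <= d * hnorm x.
  apply: hnorm_le_dual => [|y]; first by rewrite mulr_ge0 ?hnorm_ge0.
  apply: le_trans (ler_norm _) _.
  have l : ultra_lim U (fun i => rdot (T x - S i x) y) (rdot (T x - W x) y).
    rewrite rdotBl -mulN1r.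
    apply: ultra_lim_ext (ultra_limD UU (ultra_lim_cst UU (rdot (T x) y))
      (ultra_limZ UU (-1) (hW' x y))).
    by apply: filterE => i /=; rewrite mulN1r rdotBl.
  apply: (ultra_lim_le UU _ l).
  by apply: filterS2 (evV x) (evV y) => i /= [gi Vx] [_ Vy]; exact: ((hS i).2 gi).1.
have bW : bounded_op W.
  apply: (@bounded_opI _ _ _ (M + d)) => // x.
  have -> : W x = T x - (T x - W x) by rewrite opprB addrC subrK.
  by apply: le_trans (hnorm_leB _ _) _; rewrite mulrDl lerD.
exists W => //; rewrite -(vN_bicommutant vA); split=> // f Af.
have [f' bf' ff'] := adjoint_exists (bA' _ Af).
apply/funext => x; apply: rdot_ext => y /=.
rewrite (adjoint_rdot _ _ ff'); apply: WE.
apply: ultra_lim_ext (hW' x (f' y)).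
apply: filterS2 (filterI (evV x) (evV y)) (evF _ Af) => i /= [[gi Vx] [_ Vy]] [_ Ff].
by rewrite -(adjoint_rdot _ _ ff'); have [_ /(_ _ _ _ Ff Vx Vy) ->] := (hS i).2 gi.
Qed.

End WeakCompactness.

(** * Reduction to separable spaces *)

Section CountableClosure.
Context {V : zmodType}.
Implicit Types (O : set (V -> V)) (E : set V).

Lemma countable_setU (T : Type) (A B : set T) :
  countable A -> countable B -> countable (A `|` B).
Proof.
by move=> cA cB; rewrite -bigcup2inE; apply: bigcup_countable => // -[|[|]].
Qed.

Lemma countable_closure O E : countable O -> countable E -> O id ->
  exists D, [/\ countable D, E `<=` D, forall x y, D x -> D y -> D (x + y)
    & forall f x, O f -> D x -> D (f x)].
Proof.
move=> cO cE Oid.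
pose step B : set V := [set x.1 + x.2 | x in B `*` B]
  `|` [set fx.1 fx.2 | fx in O `*` B].
pose D n := iter n step E.
have DS n : D n `<=` D n.+1 by move=> x Dx; right; exists (id, x).
have Dmono n m : (n <= m)%N -> D n `<=` D m.
  elim: m => [|m IHm]; first by rewrite leqn0 => /eqP ->.
  rewrite leq_eqVlt => /predU1P[->//|]; rewrite ltnS => /IHm h.
  exact: subset_trans (DS m).
exists (\bigcup_n D n); split.
- apply: bigcup_countable => // n _; elim: n => [//|n IHn].
  by apply: countable_setU; apply: card_le_trans (card_image_le _ _) _;
    exact: countableX.
- by move=> x Ex; exists 0%N.
- move=> x y [n _ Dx] [m _ Dy]; exists (maxn n m).+1 => //; left.
  exists (x, y) => //; split => /=.
    by apply: (Dmono n); rewrite ?leq_maxl.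
  by apply: (Dmono m); rewrite ?leq_maxr.
- by move=> f x Of [n _ Dx]; exists n.+1 => //; right; exists (f, x).
Qed.

End CountableClosure.

Section SeparableSubspaces.
Context {R : realType} {H : hilbertSpace R}.
Implicit Types (S T f : H -> H) (A F O : set (H -> H)) (E D K : set H) (x y z : H).

(** [D] is obtained by closing [E] under sums, the operators of [O], and
    multiplication by rational scalars and by ['i]. *)
Lemma separable_invariant_subspace O E : countable O -> countable E ->
  O `<=` bounded_op -> exists D,
  [/\ countable D, csubspace (hclosure D), E `<=` D
    & forall f, O f -> forall x, hclosure D x -> hclosure D (f x)].
Proof.
move=> cO cE Ob.
pose scalings : set (H -> H) := range (fun q : rat => fun x : H => (ratr q : R)%:C *: x).
pose O' := O `|` (scalings `|` [set fun x : H => 'i *: x]).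
have scaleP q : O' (fun x => (ratr q : R)%:C *: x) by right; left; exists q.
have [|||D [cD ED DD DO]] := @countable_closure H O' (0 |` E).
- apply: countable_setU => //; apply: countable_setU; last exact: countable1.
  exact: card_le_trans (card_image_le _ _) (countableP _).
- by apply: countable_setU => //; exact: countable1.
- have := scaleP 1; congr O'; apply/funext => x.
  by rewrite rmorph1 rmorph1 scale1r.
have bO' f : O' f -> bounded_op f.
  move=> [/Ob //|[[q _ <-]|->]]; exact: (bop_scale _ (@bop_id R H)).
have KO f x : O' f -> hclosure D x -> hclosure D (f x).
  by move=> Of; apply: hclosure_invariant => [|y]; [exact: bO'|exact: DO].
have KD x y : hclosure D x -> hclosure D y -> hclosure D (x + y).
  move=> Kx Ky e e0; have e2 : 0 < e / 2 by rewrite divr_gt0.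
  have [[x' Dx' xx'] [y' Dy' yy']] := (Kx _ e2, Ky _ e2).
  exists (x' + y'); first exact: DD.
  by rewrite opprD addrACA; apply: le_lt_trans (hnorm_leD _ _) _; lra.
have KZr (a : R) x : hclosure D x -> hclosure D (a%:C *: x).
  move=> Kx; apply: hclosure_closed => e e0.
  have x1 : 0 < hnorm x + 1 by rewrite ltr_wpDl ?hnorm_ge0.
  have aq : a < a + e / (hnorm x + 1) by rewrite ltrDl divr_gt0.
  have [q] := rat_in_itvoo aq.
  rewrite in_itv /= => /andP[q1 q2].
  exists ((ratr q : R)%:C *: x); first exact: (KO _ _ (scaleP q)).
  rewrite -scalerBl -rmorphB hnormZr distrC gtr0_norm ?subr_gt0 //.
  have : ratr q - a < e / (hnorm x + 1) by lra.
  by rewrite ltr_pdivlMr // => h; have := hnorm_ge0 x; nra.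
exists D; split=> //.
- split=> //; first by apply: sub_hclosure; apply: ED; left.
  move=> c x Kx; rewrite [c]complexE scalerDl -scalerA.
  by apply: KD; [exact: KZr|apply: (KO _ _ _ (KZr _ _ Kx)); right; right].
- by move=> x Ex; apply: ED; right.
- by move=> f Of x; apply: KO; left.
Qed.

Section Restriction.
Variables (D : set H) (csK : csubspace (hclosure D)).
Local Notation K := (hclosure D).
Let clK : hclosed K := @hclosure_closed _ _ D.
Local Notation HK := (hsubspace csK clK).

Definition restr_op S (u : HK) : HK := hrestr csK clK (S (hval u)).

Definition lift_op (S : HK -> HK) x : H := hval (S (hrestr csK clK x)).

Lemma hsubspace_separable : countable D -> separable_space HK.
Proof.
move=> cD; exists [set hrestr csK clK x | x in D].
  exact: card_le_trans (card_image_le _ _) cD.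
apply: dense_hnorm => u e e0; have [x Dx ux] := hval_in u e e0.
exists (hrestr csK clK x); first by exists x.
by rewrite -hval_norm hvalB hval_restr hproj_id //; exact: sub_hclosure.
Qed.

Lemma hrestrD x y : hrestr csK clK (x + y) = hrestr csK clK x + hrestr csK clK y.
Proof. by apply: hval_inj; rewrite hvalD !hval_restr hprojD. Qed.

Lemma hrestrZ c x : hrestr csK clK (c *: x) = c *: hrestr csK clK x.
Proof. by apply: hval_inj; rewrite hvalZ !hval_restr hprojZ. Qed.

Lemma hrestr_norm x : hnorm (hrestr csK clK x) <= hnorm x.
Proof. by rewrite -hval_norm hval_restr hproj_norm. Qed.

Lemma restr_op_bounded S : bounded_op S -> bounded_op (restr_op S).
Proof.
move=> bS; have [M M0 hM] := bop_bound bS.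
apply: (@bounded_opI _ _ _ M) => [u v|c u|u].
- by rewrite /restr_op hvalD (bopD _ _ bS) hrestrD.
- by rewrite /restr_op hvalZ (bopZ _ _ bS) hrestrZ.
- by apply: le_trans (hrestr_norm _) _; rewrite -(hval_norm u).
Qed.

Lemma lift_op_bounded (S : HK -> HK) : bounded_op S -> bounded_op (lift_op S).
Proof.
move=> bS; have [M M0 hM] := bop_bound bS.
apply: (@bounded_opI _ _ _ M) => [x y|c x|x].
- by rewrite /lift_op hrestrD (bopD _ _ bS) hvalD.
- by rewrite /lift_op hrestrZ (bopZ _ _ bS) hvalZ.
- rewrite /lift_op hval_norm; apply: le_trans (hM _) _.
  by rewrite ler_wpM2l // hrestr_norm.
Qed.

Lemma restr_op_dot S u v : hdot (restr_op S u) v = hdot (S (hval u)) (hval v).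
Proof.
rewrite -hval_dot hval_restr (hproj_adj csK clK) hproj_id //; exact: hval_in.
Qed.

Lemma restr_op_adjoint S S' : adjoint S S' -> adjoint (restr_op S) (restr_op S').
Proof.
by move=> SS' u v; rewrite restr_op_dot SS' (hdotC (restr_op S' v)) restr_op_dot -hdotC.
Qed.

Lemma hval_restr_op S u : (forall x, K x -> K (S x)) ->
  hval (restr_op S u) = S (hval u).
Proof. by move=> KS; rewrite hval_restr hproj_id //; apply: KS; exact: hval_in. Qed.

(** [f] commutes with the projection onto the subspace, as it leaves the subspace and
    its orthogonal complement invariant. *)
Lemma restr_op_commute S f f' : bounded_op f -> adjoint f f' ->
  (forall x, K x -> K (f x)) -> (forall x, K x -> K (f' x)) ->
  S \o f = f \o S -> restr_op S \o restr_op f = restr_op f \o restr_op S.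
Proof.
move=> bf ff' Kf Kf' Sf; apply/funext => u; apply: hval_inj => /=.
rewrite [LHS]hval_restr !(hval_restr_op _ Kf) [hval (restr_op S u)]hval_restr.
rewrite -[RHS]/((f \o hproj K) _) (hproj_commute csK clK bf ff' Kf Kf') /=.
by rewrite -[S (f _)]/((S \o f) _) Sf.
Qed.

Lemma lift_op_val (S : HK -> HK) u : lift_op S (hval u) = hval (S u).
Proof. by rewrite /lift_op hrestr_val. Qed.

(** The compression of [S] in [A] lies in the commutant of the compressions of [F],
    so a pair annihilating the latter annihilates [A]. *)
Lemma ann_restr A F u v : A `<=` bounded_op -> A `<=` commutant F ->
  (forall f, F f -> exists2 f', bounded_op f' & adjoint f f') ->
  F `<=` bounded_op ->
  (forall f, F f -> forall x, K x -> K (f x)) ->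
  (forall f f', F f -> adjoint f f' -> forall x, K x -> K (f' x)) ->
  ann (commutant [set restr_op f | f in F]) u v -> ann A (hval u) (hval v).
Proof.
move=> Ab AF Fadj Fb KF KF' a S AS; rewrite -restr_op_dot; apply: a.
split; first exact/restr_op_bounded/Ab.
move=> _ [f Ff <-]; have [f' bf' ff'] := Fadj _ Ff.
apply: (restr_op_commute (f' := f')) => //; first exact: Fb.
- exact: KF.
- exact: KF' ff'.
- by have [_ ->] := AF _ AS.
Qed.

End Restriction.
End SeparableSubspaces.
Arguments restr_op {R H D} csK S u.

Section SeparableReduction.
Context {R : realType} {H : hilbertSpace R}.
Implicit Types (S T f : H -> H) (A : set (H -> H)).

Lemma not_distance_estimate A k : ~ distance_estimate A k -> exists T c d,
  [/\ bounded_op T, 0 <= c, rank_one_bound A T c, k * c < d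
    & ~ exists2 S, A S & forall x, hnorm (T x - S x) <= d * hnorm x].
Proof.
move=> h; apply: contrapT => g; apply: h => T c bT c0 hc d cd.
by apply: contrapT => n; apply: g; exists T, c, d; split.
Qed.

(** If every constant [m + 1] fails for [A], each failure is witnessed by countably
    many operators in [A'] and vectors. All of them live on one separable reducing
    subspace, and there the commutant of the compressed operators satisfies some
    distance estimate, which contradicts the failure for large [m]. *)
Lemma hyperreflexive_of_separable A :
  (forall (H' : hilbertSpace R) (B : set (H' -> H')),
     separable_space H' -> von_neumann_algebra B -> hyperreflexive B) ->
  von_neumann_algebra A -> hyperreflexive A.
Proof.
move=> sep vA; apply: distance_estimate_hyperreflexive => //.
apply: contrapT => noest.
have Ab := vN_bounded vA.
have vA' := vN_commutant vA.
(* the data on which the estimate with constant [m + 1] fails *)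
pose bad (m : nat) (w : (H -> H) * R * R * (set (H -> H) * set H)) :=
  let: (T, c, d, (F, E)) := w in
  [/\ bounded_op T, rank_one_bound A T c, 0 <= c /\ m.+1%:R * c < d,
      [/\ countable F, countable E & F `<=` commutant A]
    & forall S, bounded_op S -> ~ approx_commuting T d F E S].
have /choice[w hw] : forall m, exists w, bad m w.
  move=> m; have : ~ distance_estimate A m.+1%:R.
    by move=> h; apply: noest; exists m.+1%:R.
  move=> /not_distance_estimate[T [c [d [bT c0 hc cd nS]]]].
  have [[F [E [cF cE FA' h]]]|n] := pselect (exists F E,
    [/\ countable F, countable E, F `<=` commutant A
      & forall S, bounded_op S -> ~ approx_commuting T d F E S]).
    by exists (T, c, d, (F, E)).
  exfalso; apply: nS; apply: weak_compactness => //.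
    by apply/ltW; apply: le_lt_trans cd; rewrite mulr_ge0.
  move=> F E cF cE FA'; apply: contrapT => n'; apply: n; exists F, E; split=> //.
  by move=> S bS aS; apply: n'; exists S.
pose T m := (w m).1.1.1; pose c m := (w m).1.1.2; pose d m := (w m).1.2.
pose F m := (w m).2.1; pose E m := (w m).2.2.
have {}hw m : [/\ bounded_op (T m), rank_one_bound A (T m) (c m),
    0 <= c m /\ m.+1%:R * c m < d m,
    [/\ countable (F m), countable (E m) & F m `<=` commutant A]
    & forall S, bounded_op S -> ~ approx_commuting (T m) (d m) (F m) (E m) S].
  by have := hw m; rewrite /T /c /d /F /E; case: (w m) => [[[? ?] ?] [? ?]].
have /choice[adj hadj] : forall f : H -> H, exists f',
    bounded_op f -> bounded_op f' /\ adjoint f f'.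
  move=> f; have [bf|nf] := pselect (bounded_op f); last by exists f.
  by have [f' bf' ff'] := adjoint_exists bf; exists f'.
pose F0 := \bigcup_m F m.
have F0A' : F0 `<=` commutant A by move=> f [m _ Ff]; have [_ _ _ [_ _ h] _] := hw m; exact: h.
have F0b : F0 `<=` bounded_op by move=> f /F0A'[].
pose G := F0 `|` [set adj f | f in F0].
have GA' : G `<=` commutant A.
  move=> f [/F0A' //|[g F0g <-]]; have [bg' gg'] := hadj _ (F0b _ F0g).
  exact: (vN_selfadjoint vA' (F0A' _ F0g) bg' gg').
have Gb : G `<=` bounded_op by move=> f /GA'[].
have Gs : selfadjoint_set G.
  move=> f S [F0f|[g F0g <-]] bS fS.
    right; exists f => //; have [_ h] := hadj _ (F0b _ F0f).
    exact: adjoint_uniq h fS.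
  left; have [_ h] := hadj _ (F0b _ F0g).
  by rewrite (adjoint_uniq fS (adjointC h)).
pose O := G `|` (range T `|` [set adj (T m) | m in setT]).
have cF0 : countable F0.
  apply: bigcup_countable => [|m _]; first exact: countableP.
  by have [_ _ _ [? ? ?] _] := hw m.
have cO : countable O.
  apply: countable_setU; last first.
    by apply: countable_setU; exact: card_le_trans (card_image_le _ _) (countableP _).
  by apply: countable_setU => //; exact: card_le_trans (card_image_le _ _) cF0.
have Ob : O `<=` bounded_op.
  move=> f [/Gb //|[[m _ <-]|[m _ <-]]]; have [bT _ _ _ _] := hw m => //.
  by have [] := hadj _ bT.
have cE : countable (\bigcup_m E m).
  apply: bigcup_countable => [|m _]; first exact: countableP.
  by have [_ _ _ [? ? ?] _] := hw m.
have [D [cD csK ED KO]] := separable_invariant_subspace cO cE Ob.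
pose clK := @hclosure_closed _ _ D.
pose B := commutant [set restr_op csK f | f in G].
have KG f : G f -> forall x, hclosure D x -> hclosure D (f x).
  by move=> Gf; apply: KO; left.
have vB : von_neumann_algebra B.
  apply: commutant_vN => [_ [f Gf <-]|_ S [f Gf <-] bS fS].
    exact/restr_op_bounded/Gb.
  have [f' bf' ff'] := adjoint_exists (Gb _ Gf).
  exists f'; first exact: Gs ff'.
  exact: (adjoint_uniq (restr_op_adjoint ff') fS).
have [k k0 hk] : exists2 k, 0 < k & distance_estimate B k.
  apply: hyperreflexive_distance_estimate; apply: sep vB.
  exact: hsubspace_separable.
pose m := Num.truncn k.
have [bT hc [c0 cd] [_ _ FmA'] nS] := hw m.
have kd : k * c m < d m.
  by apply: le_lt_trans cd; rewrite ler_wpM2r // ltW // truncnS_gt.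
have KT x : hclosure D x -> hclosure D (T m x).
  by apply: KO; right; left; exists m.
have [|S BS hS] := hk (restr_op csK (T m)) (c m) (restr_op_bounded csK bT) c0 _ _ kd.
  move=> u v a; rewrite /rdot restr_op_dot -(hval_norm u) -(hval_norm v).
  apply: hc; apply: (ann_restr (F := G)) a => //.
  - by move=> S AS; apply: (commutantS GA'); exact: sub_bicommutant.
  - by move=> f /Gb/adjoint_exists.
  - move=> f f' Gf ff'; apply: KG; have [f'' bf'' ff''] := adjoint_exists (Gb _ Gf).
    by rewrite (adjoint_uniq ff' ff''); exact: Gs ff''.
have [bS cS] := BS.
have EK x : E m x -> exists u : hsubspace csK clK, hval u = x.
  by move=> Ex; apply: hval_surj; apply: sub_hclosure; apply: ED; exists m.
apply: (nS _ (lift_op_bounded bS)); split.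
  move=> _ y /EK[u <-] _; apply: le_trans (norm_rdot_CS _ _) _.
  rewrite ler_wpM2r ?hnorm_ge0 // lift_op_val -(hval_restr_op u KT) -hvalB.
  by rewrite !hval_norm; exact: hS.
move=> f _ y Ff /EK[u <-] _.
have Gf : G f by left; exists m.
rewrite -(hval_restr_op u (KG _ Gf)) !lift_op_val.
have : [set restr_op csK f | f in G] (restr_op csK f) by exists f.
move=> /cS /(congr1 (@^~ u)) /= ->.
by rewrite (hval_restr_op _ (KG _ Gf)).
Qed.

End SeparableReduction.

(** * The equivalence *)

Theorem corollary4p7 (R : realType)
  (single_gen : forall (H : hilbertSpace R) (A : set (H -> H)),
     separable_space H -> von_neumann_algebra A -> singly_generated A) :
  (forall (H : hilbertSpace R) (A : set (H -> H)) (Q : H -> H),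
     von_neumann_algebra A -> hyperreflexive A -> projection Q ->
     hyperreflexive (vN_join A (commutant (commutant [set Q]))))
  <->
  (forall (H : hilbertSpace R) (n : nat) (Q : 'I_n -> H -> H),
     (0 < n)%N -> (forall i, projection (Q i)) ->
     hyperreflexive (\bigcap_(i in [set: 'I_n]) commutant [set Q i])).
Proof.
split=> [join_hyp H n Q n0 Qp|commutant_hyp H A Q vA _ pQ].
- rewrite bigcap_commutant //.
  apply: hyperreflexive_of_separable => [H' B sepH' vB|].
    apply: hyperreflexive_of_joins (vB) (single_gen _ _ sepH' vB).
    exact: join_hyp.
  by apply: commutant_projections_vN => _ [i _ <-].
- apply: hyperreflexive_of_separable => [H' B sepH' vB|].
    apply: hyperreflexive_of_projection_commutants (vB)
      (single_gen _ _ sepH' (vN_commutant vB)).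
    by move=> Q'; exact: commutant_hyp.
  apply: vN_generated_vN => T [/(vN_bounded vA) //|].
  exact: commutant_bounded.
Qed.
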